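(* Let $m,k$ be integers with $3\le m\le k$. For all positive integers $h_m\ge h_{m+1}\ge\dots\ge h_k$, there exists a realization of the partition $(h_m^m h_{m+1}\dots h_k)$, i.e. of the partition with $m$ parts equal to $h_m$ followed by the parts $h_{m+1},\dots,h_k$.
   Context: A latin square of order $n$ is an $n\times n$ array filled with symbols from $[n]=\{1,\dots,n\}$ such that each symbol occurs exactly once in every row and every column. A subsquare of order $s$ is an $s\times s$ subarray (given by a set of $s$ rows and a set of $s$ columns, not necessarily contiguous) which is itself a latin square on some set of $s$ symbols. Subsquares are disjoint if they share no rows, columns or symbols. Given an integer partition $P=(p_1\dots p_k)$ of $n$ (positive integers $p_i$ with $\sum_i p_i=n$), a realization of $P$ is a latin square of order $n$ with pairwise disjoint subsquares of orders $p_1,\dots,p_k$. In partition notation, an exponent denotes multiplicity: $a^m$ means $m$ parts equal to $a$. *)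

(* Defs.v *)
From mathcomp Require Import all_boot all_order all_algebra.

Set Implicit Arguments.
Unset Strict Implicit.
Unset Printing Implicit Defensive.

(* The symbol set [n] is encoded, like the row and column indices, by 'I_n. *)

(* The subarray of L on rows R and columns C is a latin square on the symbols
   S: it is square of order #|S|, is filled from S, and every symbol of S
   occurs exactly once in each of its rows and each of its columns. *)
Definition latin_on (n : nat) (L : 'M['I_n]_n) (R C S : {set 'I_n}) : Prop :=
  [/\ #|R| = #|S| /\ #|C| = #|S|,
      forall r c, r \in R -> c \in C -> L r c \in S,
      forall r x, r \in R -> x \in S -> exists! c, c \in C /\ L r c = x &
      forall c x, c \in C -> x \in S -> exists! r, r \in R /\ L r c = x].

Definition latin_square (n : nat) (L : 'M['I_n]_n) : Prop :=
  latin_on L [set: 'I_n] [set: 'I_n] [set: 'I_n].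

Definition subsquare (n : nat) (L : 'M['I_n]_n) (s : nat)
    (R C S : {set 'I_n}) : Prop :=
  #|S| = s /\ latin_on L R C S.

Definition integer_partition (n : nat) (P : seq nat) : Prop :=
  (forall p, p \in P -> 0 < p) /\ sumn P = n.

(* Parts of equal size are distinguished by their position in P, so that a
   part of multiplicity a requires a different disjoint subsquares. *)
Definition realization (n : nat) (P : seq nat) (L : 'M['I_n]_n) : Prop :=
  [/\ integer_partition n P,
      latin_square L &
      exists R C S : 'I_(size P) -> {set 'I_n},
        (forall i : 'I_(size P), subsquare L (nth 0 P i) (R i) (C i) (S i)) /\
        (forall i j : 'I_(size P), i != j ->
           [/\ [disjoint R i & R j], [disjoint C i & C j] &
               [disjoint S i & S j]])].

(* Main.v *)
Require Import Defs.
From mathcomp Require Import all_boot all_order all_algebra.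
From mathcomp Require Import zify.

Set Implicit Arguments.
Unset Strict Implicit.
Unset Printing Implicit Defensive.

Import GRing.Theory.

(* Write a = h_m, let the parts other than three copies of a be split into
   "units" of weight 1, and let s be their sum.  By Hilton's amalgamation theorem
   it suffices to find an outline square: a weight x(i,j,l) >= 0 on triples of
   classes (units and the three large parts) with the right marginals, such that
   the diagonal cell of each part carries only its own symbols; equitable edge
   colourings then split the classes one side at a time.
   An outline is determined by a partial latin square T on the units (the
   unit-unit-unit triples): the uncovered row-column, row-symbol and
   column-symbol pairs have to be distributed over the three large parts so that
   the defects fit together.  When s is small T consists of the subsquares of the
   small parts alone, and a single equitable 3-colouring of the uncovered pairs
   works cyclically for all three kinds of pairs.  When s is large T also
   contains layers {(u, u+d, u+e)} of Z_s, with all differences outside the range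
   occupied by the subsquares, so that every unit has at most 3a uncovered pairs;
   balanced 2-colourings of the uncovered pairs give the distribution. *)

(** With three large parts, the cell of two distinct ones may hold symbols of the third, up to
    weight a * a; what the units take from it must be the same amount in the row, column and symbol
    counts. This bounds T on two sides. A unit may have at most 3a uncovered pairs, a for each large
    part. The total size of T may be at most 4a^2 + s^2 - 3as, which keeps what the units take from
    each large cell within a * a. The own block of a unit covers at least one pair, so s - 3a - 1
    layers meet the first demand; but with large blocks that many full layers may violate the
    second, and some layers are then kept only where units in small blocks need them. Let b be the
    largest small part. The two cases meet at a + 2b <= s + 1: the blocks leave s + 1 - 2b
    differences free, and besides the layers a of these are needed to form regular relations of
    degree a. *)

(** * Balanced colourings *)

(* f exchanges the orbits of g \o f in pairs: if an orbit were mapped to itself,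
   f or g would have a fixed point half way along it. *)
Lemma alternating_coloring_free (T : finType) (f g : T -> T) :
  involutive f -> involutive g ->
  (forall x, f x != x) -> (forall x, g x != x) ->
  exists c : pred T, forall x, c (f x) = ~~ c x /\ c (g x) = ~~ c x.
Proof.
move=> fK gK ff gf; pose phi := g \o f.
have phiI : injective phi := inj_comp (inv_inj gK) (inv_inj fK).
pose rt := froot phi.
have csym := fconnect_sym phiI.
have rtphi x : rt (g (f x)) = rt x.
  by apply/esym/(fingraph.rootP csym); apply: (fconnect1 phi).
have rtg x : rt (g x) = rt (f x) by rewrite -(rtphi (f x)) fK.
have rtfg x : rt (f (g x)) = rt x by rewrite -rtphi fK gK.
have iterf n x : iter n phi (f (iter n phi x)) = f x.
  by elim: n => //= n IHn; rewrite -iterS iterSr {2}/phi /= fK gK.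
have iterI n : injective (iter n phi).
  by elim: n => // n IHn x y /= /phiI/IHn.
have rt_neq x : rt x != rt (f x).
  apply/eqP => /(fingraph.rootP csym)/iter_findex.
  move: (findex _ _ _) => n; rewrite -(odd_double_half n) -addnn addnCA !iterD.
  rewrite -(iterf n./2) => /iterI; move: (iter n./2 _ _) => z.
  case: (odd n) => /= /esym e; last by have := ff z; rewrite e eqxx.
  by move: (gf (f z)); rewrite -[g (f z)]/(phi z) -e eqxx.
(* Of two orbits exchanged by [f], the one with the smaller root gets the colour true. *)
exists (fun x => enum_rank (rt x) < enum_rank (rt (f x))) => x.
rewrite fK rtg rtfg -leqNgt [RHS]leq_eqVlt; case: eqP => // /val_inj/enum_rank_inj e.
by have := rt_neq x; rewrite e eqxx.
Qed.

(* A fixed point x is made harmless by exchanging its two copies in T * bool. *)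
Lemma alternating_coloring (T : finType) (f g : T -> T) :
  involutive f -> involutive g ->
  exists c : pred T, forall x,
    (f x != x -> c (f x) = ~~ c x) /\ (g x != x -> c (g x) = ~~ c x).
Proof.
move=> fK gK.
pose dbl (f : T -> T) (p : T * bool) :=
  if f p.1 == p.1 then (p.1, ~~ p.2) else (f p.1, p.2).
have dblK (h : T -> T) : involutive h -> involutive (dbl h).
  move=> hK [x b]; rewrite /dbl /=; case: (eqVneq (h x) x) => [e|n] /=.
    by rewrite e eqxx negbK.
  by rewrite hK eq_sym (negPf n).
have dbl_free (h : T -> T) p : dbl h p != p.
  case: p => x b; rewrite /dbl /=.
  case: (eqVneq (h x) x) => [_|n]; apply/eqP => -[]; first by case: b.
  exact/eqP.
have [c cP] := alternating_coloring_free (dblK _ fK) (dblK _ gK)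
  (dbl_free f) (dbl_free g).
exists (fun x => c (x, false)) => x.
by have := cP (x, false); rewrite /dbl /=; do 2!case: eqP => _; case; split.
Qed.

Definition balanced (T : finType) (c A : pred T) :=
  (#|[pred x | A x & c x]| <= #|[pred x | A x & ~~ c x]|.+1) &&
  (#|[pred x | A x & ~~ c x]| <= #|[pred x | A x & c x]|.+1).

(** [b] matches elements of [A] of opposite colours, and at most one element of [A] is left
    unmatched. *)
Lemma balanced_alternating (T : finType) (b : T -> T) (c A : pred T) :
  involutive b -> (forall x, A x -> A (b x)) ->
  (forall x, b x != x -> c (b x) = ~~ c x) ->
  (forall x y, A x -> A y -> b x = x -> b y = y -> x = y) -> balanced c A.
Proof.
move=> bK bA bc b1.
suff H (d : pred T) : (forall x, b x != x -> d (b x) = ~~ d x) ->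
  #|[pred x | A x & d x]| <= #|[pred x | A x & ~~ d x]|.+1.
  apply/andP; split; first exact: H.
  apply: leq_trans (H (predC c) _) _.
    by move=> x /bc /= ->.
  by rewrite ltnS; apply/subset_leq_card/subsetP=> x; rewrite !inE /= negbK.
move=> bd; rewrite -(cardID [pred x | b x == x]) addnC -addn1 leq_add //.
  rewrite -(card_image (inv_inj bK)); apply/subset_leq_card/subsetP => y /imageP[x + ->].
  by rewrite !inE => /and3P[nx Ax dx]; rewrite bA // bd // dx.
apply/card_le1_eqP => x y; rewrite !inE => /andP[/andP[Ax _] /eqP bx].
by move=> /andP[/andP[Ay _] /eqP yb]; apply: b1.
Qed.

(** As long as two related points are fixed, they are exchanged; each exchange lowers the number of
    fixed points and breaks no pair of [a]. *)
Lemma extend_pairing (T : finType) (R : rel T) (a : T -> T) :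
  equivalence_rel R -> involutive a -> (forall x, R x (a x)) ->
  exists b : T -> T, [/\ involutive b, forall x, R x (b x),
    forall x, a x != x -> b x = a x &
    forall x y, R x y -> b x = x -> b y = y -> x = y].
Proof.
move=> eqR; have [n] := ubnP #|[pred x | a x == x]|.
elim: n a => // n IHn a len aK aR.
case: (pickP [pred p : T * T |
  [&& R p.1 p.2, a p.1 == p.1, a p.2 == p.2 & p.1 != p.2]]) => [[x y]|none] /=.
  case/and4P=> Rxy /eqP ax /eqP ay nxy.
  pose a' z := if z == x then y else if z == y then x else a z.
  have nyx : (y == x) = false by rewrite eq_sym (negPf nxy).
  have aE z w : a w = w -> (a z == w) = (z == w).
    by move=> aw; rewrite -{1}aw (inj_eq (inv_inj aK)).
  have a'K : involutive a'.
    move=> z; rewrite /a'; case: (eqVneq z x) => [->|zx]; first by rewrite nyx eqxx.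
    case: (eqVneq z y) => [->|zy]; first by rewrite eqxx.
    by rewrite !aE // (negPf zx) (negPf zy) aK.
  have Ryx : R y x by have [Rxx e] := eqR x y x; rewrite -e.
  have a'R z : R z (a' z).
    by rewrite /a'; case: eqP => [->|_] //; case: eqP => [->|].
  have [|b [bK bR ba b1]] := IHn a' _ a'K a'R.
    rewrite -ltnS; apply: leq_trans len; rewrite ltnS; apply/proper_card/properP; split.
      apply/subsetP=> z; rewrite !inE /a'; case: (eqVneq z x) => [->|_]; first by rewrite nyx.
      by case: (eqVneq z y) => [->|_] //; rewrite (negPf nxy).
    by exists x; rewrite !inE /a' ?ax // eqxx nyx.
  exists b; split => // z az.
  have a'z : a' z = a z.
    rewrite /a'; case: eqP => [e|_]; first by rewrite e ax eqxx in az.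
    by case: eqP => [e|_] //; rewrite e ay eqxx in az.
  by rewrite -a'z ba // a'z.
exists a; split=> // x y Rxy ax ay; apply/eqP; apply: contraFT (none (x, y)).
by move=> nxy /=; rewrite Rxy ax ay !eqxx.
Qed.

(* The levels of a laminar family, from fine to coarse, as equivalence relations. *)
Fixpoint chain (T : finType) (R : rel T) (Rs : seq (rel T)) : Prop :=
  if Rs is R' :: Rs' then [/\ equivalence_rel R', subrel R R' & chain R' Rs']
  else True.

(** One involution serves every level: a coarser level pairs only the points that the finer ones
    left over, so each class consists of pairs and at most one further point. *)
Lemma chain_pairing (T : finType) (R : rel T) (Rs : seq (rel T)) (a : T -> T) :
  chain R Rs -> involutive a -> (forall x, R x (a x)) ->
  exists b : T -> T, [/\ involutive b, forall x, a x != x -> b x = a x &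
    forall c : pred T, (forall x, b x != x -> c (b x) = ~~ c x) ->
      all (fun S => [forall x, balanced c (S x)]) Rs].
Proof.
elim: Rs R a => [|R' Rs IHRs] R a /=; first by move=> _ aK _; exists a; split.
case=> eqR' sRR' chRs aK aR.
have [b [bK bR ba b1]] := extend_pairing eqR' aK (fun x => sRR' _ _ (aR x)).
have [d [dK db dRs]] := IHRs _ _ chRs bK bR.
exists d; split => // [x ax|c cd]; first by rewrite db ba.
rewrite dRs // andbT; apply/forallP => z.
apply: (balanced_alternating (b := b)) => // [x Rzx|x bx|x y Rzx Rzy].
- by have [_ ->] := eqR' z x (b x).
- by rewrite -db // cd // db.
by apply: b1; have [_ <-] := eqR' z x y.
Qed.

(** Each chain yields one involution, and a colouring that alternates along both balances both
    chains. Two chains are the limit of this argument, since a third involution could close odd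
    cycles. *)
Lemma laminar_2coloring (T : finType) (Ls Rs : seq (rel T)) :
  chain eq_op Ls -> chain eq_op Rs ->
  exists c : pred T, all (fun S => [forall x, balanced c (S x)]) (Ls ++ Rs).
Proof.
move=> chL chR.
have [a [aK _ aL]] := chain_pairing (a := id) chL (fun=> erefl) (fun=> eqxx _).
have [b [bK _ bR]] := chain_pairing (a := id) chR (fun=> erefl) (fun=> eqxx _).
have [c cP] := alternating_coloring aK bK.
by exists c; rewrite all_cat aL ?bR // => x; case: (cP x).
Qed.

Lemma chain_restrict (T : finType) (S : pred T) (R : rel T) (Rs : seq (rel T)) :
  chain R Rs ->
  chain (fun x y => R x y && (S x == S y))
    [seq (fun x y => Q x y && (S x == S y)) | Q : rel T <- Rs].
Proof.
elim: Rs R => //= Q Rs IHRs R [eqQ sRQ /IHRs chQ]; split=> //.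
  move=> x y z; rewrite eqxx andbT; have [-> e] := eqQ x y z; split=> //.
  by case/andP=> /e -> /eqP->.
by move=> x y /andP[/sRQ -> ->].
Qed.

Lemma chain_nth (T : finType) (R0 R : rel T) (Rs : seq (rel T)) (n : nat) :
  chain R Rs -> n < size Rs -> equivalence_rel (nth R0 Rs n).
Proof.
elim: Rs R n => //= Q Rs IHRs R [|n] [eqQ _ chQ] //; exact: IHRs chQ.
Qed.

(** Every level is refined by membership in [S]; the class of a point of [S] is then the trace of
    its old class on [S]. *)
Lemma laminar_2coloring_on (T : finType) (S : pred T) (Ls Rs : seq (rel T)) :
  chain eq_op Ls -> chain eq_op Rs ->
  exists c : pred T,
    all (fun R : rel T => [forall x, balanced c (fun y => R x y && S y)]) (Ls ++ Rs).
Proof.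
move=> chL chR.
have chain_eq Qs : chain eq_op Qs -> chain eq_op
    [seq (fun x y => Q x y && (S x == S y)) | Q : rel T <- Qs].
  move/(chain_restrict S); case: Qs => //= Q Qs [eqQ _ ?]; split=> // x y /eqP->.
  exact: (eqQ y y y).1.
have [c] := laminar_2coloring (chain_eq _ chL) (chain_eq _ chR).
rewrite -map_cat all_map => cP; exists c.
apply/(all_nthP eq_op) => n nin; apply/forallP => x.
have {cP} := (all_nthP eq_op cP) n nin => /forallP /=.
have : equivalence_rel (nth eq_op (Ls ++ Rs) n).
  rewrite nth_cat; case: ltnP => [|le_n]; first exact: chain_nth chL.
  by apply: chain_nth chR _; rewrite ltn_subLR // -size_cat.
move: (nth _ _ _) => R eqR cR.
case: (pickP [pred y | R x y && S y]) => [y /= /andP[Rxy Sy]|none].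
  have Rz z : R y z && (S y == S z) = R x z && S z.
    by have [_ ->] := eqR x y z; rewrite // Sy; case: (S z).
  have := cR y; rewrite /balanced.
  by congr ((_ <= _.+1) && (_ <= _.+1)); apply: eq_card => z; rewrite !inE Rz.
by rewrite /balanced !eq_card0 // => z; rewrite !inE; have /= -> := none z.
Qed.

Definition color_count (T : finType) (K : eqType) (c : T -> K) (A : pred T) (i : K) :=
  #|[pred y | A y & c y == i]|.

Definition equitable (T : finType) (k : nat) (c : T -> 'I_k) (A : pred T) :=
  [forall i, forall j, color_count c A i <= (color_count c A j).+1].

Lemma leq_sum_seq (I : Type) (r : seq I) (F G : I -> nat) :
  all (fun i => F i <= G i) r -> \sum_(i <- r) F i <= \sum_(i <- r) G i ?= iff
  all (fun i => G i <= F i) r.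
Proof.
elim: r => [|i r IHr] /=; first by rewrite !big_nil.
case/andP=> Fi /IHr Fr; rewrite !big_cons; apply: leqif_add => //.
exact: leqif_geq.
Qed.

(* A colouring minimising the sum of the squared colour counts is equitable, since
   two colours whose counts differ by more than one can be redistributed by a
   balanced 2-colouring of their union. *)
Lemma equitable_coloring (T : finType) (k : nat) (Ls Rs : seq (rel T)) :
  0 < k -> chain eq_op Ls -> chain eq_op Rs ->
  exists c : T -> 'I_k, all (fun S => [forall x, equitable c (S x)]) (Ls ++ Rs).
Proof.
move=> k0 chL chR.
pose phi (c : {ffun T -> 'I_k}) (S : rel T) :=
  \sum_x \sum_i color_count c (S x) i ^ 2.
pose c0 : {ffun T -> 'I_k} := [ffun=> Ordinal k0].
case: (arg_minnP (fun c => \sum_(S <- Ls ++ Rs) phi c S) (erefl : xpredT c0)).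
move=> c _ min_c; exists c; apply/negbNE/negP => neq_c.
suff [c' [le_c' lt_c']] : exists c' : {ffun T -> 'I_k},
    all (fun S => phi c' S <= phi c S) (Ls ++ Rs) /\
    ~~ all (fun S => phi c S <= phi c' S) (Ls ++ Rs).
  have := min_c c' isT; rewrite leqNgt => /negP[].
  by rewrite (ltn_leqif (leq_sum_seq le_c')).
have [i [j [R0 [x0 [R0in lt_ij]]]]] : exists i j (R0 : nat) x0,
    R0 < size (Ls ++ Rs) /\ (color_count c (nth eq_op (Ls ++ Rs) R0 x0) j).+1 <
      color_count c (nth eq_op (Ls ++ Rs) R0 x0) i.
  move: neq_c; rewrite -has_predC => /(has_nthP eq_op)[R0 R0in /=].
  rewrite negb_forall => /existsP[x0]; rewrite negb_forall => /existsP[i].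
  rewrite negb_forall => /existsP[j]; rewrite -ltnNge => lt_ij.
  by exists i, j, R0, x0.
have nij : j != i by apply/eqP => e; move: lt_ij; rewrite e; lia.
have [S SE] : exists S : pred T, forall y, S y = (c y == i) || (c y == j).
  by exists [pred y | (c y == i) || (c y == j)].
have [d dP] := laminar_2coloring_on S chL chR.
pose c' := [ffun y => if S y then if d y then i else j else c y].
have c'i (A : pred T) : color_count c' A i = #|[pred y | A y & S y && d y]|.
  apply: eq_card => y; rewrite !inE ffunE; case: (boolP (S y)) => //=.
    by case: (d y); rewrite ?eqxx ?(negPf nij).
  by rewrite SE negb_or => /andP[/negPf->].
have c'j (A : pred T) : color_count c' A j = #|[pred y | A y & S y && ~~ d y]|.
  apply: eq_card => y; rewrite !inE ffunE; case: (boolP (S y)) => //=.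
    by case: (d y); rewrite ?eqxx // eq_sym (negPf nij).
  by rewrite SE negb_or => /andP[_ /negPf->].
have c't (A : pred T) t : t != i -> t != j -> color_count c' A t = color_count c A t.
  move=> ti tj; apply: eq_card => y; rewrite !inE ffunE.
  case: ifP => //; rewrite SE.
  by case/orP=> /eqP->; case: (d y); rewrite !(eq_sym _ t) ?(negPf ti) ?(negPf tj).
have c'ij (A : pred T) :
    color_count c' A i + color_count c' A j = color_count c A i + color_count c A j.
  rewrite c'i c'j; transitivity #|[pred y | A y & S y]|.
    rewrite -(cardID d [pred y | A y & S y]); congr (_ + _); apply: eq_card => y.
      by rewrite !inE andbA.
    by rewrite !inE andbA andbC.
  rewrite -(cardID [pred y | c y == i] [pred y | A y & S y]).
  congr (_ + _); apply: eq_card => y; rewrite !inE SE /=.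
    by case: (A y); case: (c y == i); case: (c y == j).
  case: (eqVneq (c y) j) => [->|_]; first by rewrite (negPf nij); case: (A y).
  by case: (A y); case: (c y == i).
have c'_bal : all (fun R : rel T => [forall x,
   (color_count c' (R x) i <= (color_count c' (R x) j).+1) &&
   (color_count c' (R x) j <= (color_count c' (R x) i).+1)]) (Ls ++ Rs).
  apply: sub_all dP => R /forallP dR; apply/forallP => x; have := dR x.
  rewrite c'i c'j /balanced.
  by congr ((_ <= _.+1) && (_ <= _.+1)); apply: eq_card => z; rewrite !inE andbA.
(* Two counts with a given sum have the least sum of squares when they differ by at most one;
   equality holds only if the old counts did so already. *)
have sq (R : rel T) x :
   (color_count c' (R x) i <= (color_count c' (R x) j).+1) &&
   (color_count c' (R x) j <= (color_count c' (R x) i).+1) ->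
   \sum_i color_count c' (R x) i ^ 2 <= \sum_i color_count c (R x) i ^ 2
     ?= iff (color_count c (R x) i <= (color_count c (R x) j).+1) &&
   (color_count c (R x) j <= (color_count c (R x) i).+1).
  rewrite (bigD1 i) //= (bigD1 j) //= [X in _ <= X ?= iff _](bigD1 i) //=.
  rewrite [X in _ <= _ + X ?= iff _](bigD1 j) //= !addnA.
  under eq_bigr => t /andP[ti tj] do rewrite c't //.
  have := c'ij (R x); move: (color_count c' _ _) (color_count c' _ _) => p q.
  move: (color_count c _ _) (color_count c _ _) => p' q' e /andP[pq qp].
  move: (\sum_(_ < _ | _) _) => r.
  have [/andP[pq' qp']|n] := boolP (_ && _).
    have [[-> ->]|[-> ->]] : (p = p' /\ q = q') \/ (p = q' /\ q = p') by lia.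
      exact/leqif_refl.
    by rewrite (addnC (q' ^ 2)); apply/leqif_refl.
  suff lt : p ^ 2 + q ^ 2 < p' ^ 2 + q' ^ 2 by split; [lia | by apply/eqP; lia].
  have [lt|lt] : p' > q'.+1 \/ q' > p'.+1 by lia.
    nia.
  nia.
have R0_bal R : R < size (Ls ++ Rs) -> forall x, _ :=
  fun Rin => forallP (all_nthP eq_op c'_bal R Rin).
exists c'; split.
  apply: sub_all c'_bal => R /forallP bR; apply: leq_sum => x _.
  exact: sq (bR x).
apply/negP => /(all_nthP eq_op)/(_ _ R0in); rewrite leqNgt => /negP[].
rewrite /phi (bigD1 x0) //= [X in _ < X](bigD1 x0) //= -addSn leq_add //.
  by rewrite (ltn_leqif (sq _ _ (R0_bal _ R0in x0))) negb_and -ltnNge lt_ij.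
by apply: leq_sum => x _; apply: sq (R0_bal _ R0in x).
Qed.

Lemma color_count_sum (T K : finType) (c : T -> K) (A : pred T) :
  \sum_i color_count c A i = #|[pred y | A y]|.
Proof.
rewrite -sum1_card (partition_big c xpredT) //=; apply: eq_bigr => i _.
by rewrite /color_count -sum1_card; apply: eq_bigl => y; rewrite !inE.
Qed.

Lemma equitable_bounds (T : finType) (k : nat) (c : T -> 'I_k) (A : pred T) t :
  equitable c A ->
  k * color_count c A t <= #|[pred y | A y]| + k.-1 /\
  #|[pred y | A y]| <= k * color_count c A t + k.-1.
Proof.
move=> eqA; rewrite -(color_count_sum c) (bigD1 t) //=.
set m := color_count c A t.
have k_pred : \sum_(i < k | i != t) 1 = k.-1.
  rewrite sum1_card; have := cardC1 t; rewrite card_ord => <-.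
  by apply: eq_card => i; rewrite !inE.
have k0 : 0 < k by apply: leq_ltn_trans (ltn_ord t).
have le i : color_count c A i <= m.+1 by have /forallP/(_ i)/forallP := eqA; apply.
have ge i : m <= (color_count c A i).+1 by have /forallP/(_ t)/forallP := eqA; apply.
have le_sum : \sum_(i < k | i != t) color_count c A i <= k.-1 * m.+1.
  by rewrite -k_pred big_distrl /=; apply: leq_sum => i _; rewrite mul1n.
have ge_sum : k.-1 * m <= \sum_(i < k | i != t) color_count c A i + k.-1.
  by rewrite -{2}k_pred -big_split -k_pred big_distrl /=; apply: leq_sum => i _;
    rewrite mul1n addn1.
have e : k * m = m + k.-1 * m by rewrite -mulSn prednK.
move: le_sum; rewrite mulnS e; clearbody m; move: ge_sum.
move: (\sum_(_ < _ | _) _) (k.-1 * m) => r q; lia.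
Qed.

Lemma equitable_exact (T : finType) (k n : nat) (c : T -> 'I_k) (A : pred T) t :
  equitable c A -> #|[pred y | A y]| = k * n -> color_count c A t = n.
Proof.
move/(equitable_bounds t)=> [le ge] e; move: le ge; rewrite e.
have k0 : 0 < k by apply: leq_ltn_trans (ltn_ord t).
by move: (color_count _ _ _) => m; nia.
Qed.

Definition kernel (T : Type) (X : eqType) (l : T -> X) : rel T := fun x y => l x == l y.

Lemma kernel_equiv (T : Type) (X : eqType) (l : T -> X) : equivalence_rel (kernel l).
Proof. by move=> x y z; rewrite /kernel eqxx; split=> // /eqP->. Qed.

Lemma sub_kernel_eq (T X : eqType) (l : T -> X) : subrel eq_op (kernel l).
Proof. by move=> x y /eqP->; apply: eqxx. Qed.

Lemma equitable_kernel (T : finType) (X : eqType) (k : nat) (c : T -> 'I_k)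
    (l : T -> X) (x : X) :
  0 < k -> (forall e, equitable c (kernel l e)) -> equitable c (fun e => l e == x).
Proof.
move=> k0 eqc; case: (pickP [pred e | l e == x]) => [e /= /eqP <-|none].
  have := eqc e; apply: etrans; apply: eq_forallb => i; apply: eq_forallb => j.
  by congr (_ <= _.+1); apply: eq_card => y; rewrite !inE /kernel (eq_sym (l e)).
apply/forallP => i; apply/forallP => j; rewrite /color_count eq_card0 // => y.
by rewrite !inE [l y == x](none y).
Qed.

(** The fibre of [p] over i gets its own w i colours, equitable on the classes of [f] and of [g] at
    once; a class whose size is a multiple of w i is then split exactly. Colours are natural numbers
    because their range depends on the fibre. *)
Lemma exact_splitting (T I : finType) (X Y : eqType) (w : I -> nat) (p : T -> I)
    (f : T -> X) (g : T -> Y) :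
  (forall i, 0 < w i) ->
  exists c : T -> nat, [/\ forall e, c e < w (p e),
    forall i x n t, t < w i -> #|[pred e | (p e == i) && (f e == x)]| = w i * n ->
      #|[pred e | [&& p e == i, f e == x & c e == t]]| = n &
    forall i y n t, t < w i -> #|[pred e | (p e == i) && (g e == y)]| = w i * n ->
      #|[pred e | [&& p e == i, g e == y & c e == t]]| = n].
Proof.
move=> w0; pose ok i (c : T -> 'I_(w i)) :=
  (forall x, equitable c (fun e => (p e, f e) == x)) /\
  (forall y, equitable c (fun e => (p e, g e) == y)).
have /fin_all_exists[c cP] : forall i, exists c, @ok i c.
  move=> i; have chK (Z : eqType) (h : T -> Z) : chain eq_op [:: kernel h].
    by split; [apply: kernel_equiv | apply: sub_kernel_eq |].
  have [c /and3P[/forallP cf /forallP cg _]] :=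
    equitable_coloring (w0 i) (chK _ (fun e => (p e, f e))) (chK _ (fun e => (p e, g e))).
  by exists c; split => x; apply: equitable_kernel.
have split_ok (Z : eqType) (h : T -> Z) :
    (forall i z, equitable (c i) (fun e => (p e, h e) == z)) ->
    forall i z n t, t < w i -> #|[pred e | (p e == i) && (h e == z)]| = w i * n ->
      #|[pred e | [&& p e == i, h e == z & val (c (p e) e) == t]]| = n.
  move=> eqh i z n t lt_t eq_n.
  rewrite -[RHS](equitable_exact (Ordinal lt_t) (eqh i (i, z))).
    apply: eq_card => e; rewrite !inE xpair_eqE -andbA.
    by case: eqP => // e1; case: eqP => //= _; rewrite -val_eqE /= e1.
  by rewrite -eq_n; apply: eq_card => e; rewrite !inE.
exists (fun e => val (c (p e) e)); split=> [e||].
- exact: ltn_ord.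
- by apply: split_ok => i z; case: (cP i).
by apply: split_ok => i z; case: (cP i).
Qed.

(** * Outline squares *)

Lemma card_tagged_ord (J : finType) (x : J -> nat) (P : pred J) :
  #|[pred e : {j : J & 'I_(x j)} | P (tag e)]| = \sum_(j | P j) x j.
Proof.
transitivity (\sum_(j | P j) \sum_(k < x j) 1); last first.
  by apply: eq_bigr => j _; rewrite sum1_card card_ord.
by rewrite sig_big_dep -sum1_card; apply: eq_bigl => e; rewrite /= andbT.
Qed.

Lemma sum_triples (I J K : finType) (P : I -> J -> K -> bool) (F : I -> J -> K -> nat) :
  \sum_(q : I * J * K | P q.1.1 q.1.2 q.2) F q.1.1 q.1.2 q.2 =
  \sum_i \sum_j \sum_(l | P i j l) F i j l.
Proof.
rewrite (pair_big_dep xpredT (fun _ _ => true) (fun i j => \sum_(l | P i j l) F i j l)) /=.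
rewrite (pair_big_dep xpredT (fun p l => P p.1 p.2 l) (fun p l => F p.1 p.2 l)) /=.
by apply: eq_bigl => q.
Qed.

(* Hilton's theorem: the x i j l copies of each triple are coloured by the rows of
   class i, then by the columns of class j, then by the symbols of class l. *)
Lemma outline_latin (I : finType) (w : I -> nat) (x : I -> I -> I -> nat) :
  (forall i, 0 < w i) ->
  (forall i j, \sum_l x i j l = w i * w j) ->
  (forall i l, \sum_j x i j l = w i * w l) ->
  (forall j l, \sum_i x i j l = w j * w l) ->
  exists L : {i : I & 'I_(w i)} -> {i : I & 'I_(w i)} -> {i : I & 'I_(w i)},
    [/\ forall p, injective (L p), forall q, injective (L^~ q) &
      forall p q, 0 < x (tag p) (tag q) (tag (L p q))].
Proof.
move=> w0 x12 x13 x23.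
pose E := {j : I * I * I & 'I_(x j.1.1 j.1.2 j.2)}.
pose ri (e : E) := (tag e).1.1; pose ci (e : E) := (tag e).1.2.
pose si (e : E) := (tag e).2.
have card_cells (P : I -> I -> I -> bool) : #|[pred e | P (ri e) (ci e) (si e)]| =
    \sum_i \sum_j \sum_(l | P i j l) x i j l.
  rewrite -(sum_triples P x).
  exact: (card_tagged_ord (fun j => x j.1.1 j.1.2 j.2) (fun j => P j.1.1 j.1.2 j.2)).
have card12 i j : #|[pred e | (ri e == i) && (ci e == j)]| = w i * w j.
  rewrite (card_cells (fun i' j' _ => (i' == i) && (j' == j))) -x12.
  rewrite (bigD1 i) //= [X in _ + X]big1 ?addn0 => [|i' ni]; last first.
    by apply: big1 => j' _; apply: big_pred0 => l; rewrite (negPf ni).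
  rewrite (bigD1 j) //= [X in _ + X]big1 ?addn0 => [|j' nj]; last first.
    by apply: big_pred0 => l; rewrite (negPf nj) andbF.
  by rewrite !eqxx.
have card13 i l : #|[pred e | (ri e == i) && (si e == l)]| = w i * w l.
  rewrite (card_cells (fun i' _ l' => (i' == i) && (l' == l))) -x13.
  rewrite (bigD1 i) //= [X in _ + X]big1 ?addn0 => [|i' ni]; last first.
    by apply: big1 => j' _; apply: big_pred0 => l'; rewrite (negPf ni).
  by rewrite eqxx; apply: eq_bigr => j _; rewrite big_pred1_eq.
have card23 j l : #|[pred e | (ci e == j) && (si e == l)]| = w j * w l.
  rewrite (card_cells (fun _ j' l' => (j' == j) && (l' == l))) -x23.
  apply: eq_bigr => i _.
  rewrite (bigD1 j) //= [X in _ + X]big1 ?addn0 => [|j' nj]; last first.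
    by apply: big_pred0 => l'; rewrite (negPf nj).
  by rewrite eqxx big_pred1_eq.
have [c1 [c1w c1c c1s]] := exact_splitting ri ci si w0.
have {}c1c i j t (lt_t : t < w i) := c1c i j (w j) t lt_t (card12 i j).
have {}c1s i l t (lt_t : t < w i) := c1s i l (w l) t lt_t (card13 i l).
(* The row classes now include the colour [c1], so the column colours separate single cells, each of
   which receives one element. *)
have [c2 [c2w c2r c2s]] := exact_splitting ci (fun e => (ri e, c1 e)) si w0.
have {}c2s j l t (lt_t : t < w j) := c2s j l (w l) t lt_t (card23 j l).
have {}c2r i j t u : t < w i -> u < w j ->
    #|[pred e | [&& ri e == i, c1 e == t, ci e == j & c2 e == u]]| = 1.
  move=> lt_t lt_u; have := c2r j (i, t) 1 u lt_u.
  rewrite muln1 -(c1c i j t) // => <-; apply: eq_card => e; rewrite !inE xpair_eqE.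
    by case: (ri e == i); case: (c1 e == t); case: (ci e == j).
  by case: (ri e == i); case: (c1 e == t); case: (ci e == j).
(* Rows and columns both enter with class and colour, so each symbol occurs once in each row and
   once in each column. *)
have [c3 [c3w c3r c3c]] :=
  exact_splitting si (fun e => (ri e, c1 e)) (fun e => (ci e, c2 e)) w0.
have {}c3r i l t u : t < w i -> u < w l ->
    #|[pred e | [&& ri e == i, c1 e == t, si e == l & c3 e == u]]| = 1.
  move=> lt_t lt_u; have := c3r l (i, t) 1 u lt_u.
  rewrite muln1 -(c1s i l t) // => <-; apply: eq_card => e; rewrite !inE xpair_eqE.
    by case: (ri e == i); case: (c1 e == t); case: (si e == l).
  by case: (ri e == i); case: (c1 e == t); case: (si e == l).
have {}c3c j l t u : t < w j -> u < w l ->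
    #|[pred e | [&& ci e == j, c2 e == t, si e == l & c3 e == u]]| = 1.
  move=> lt_t lt_u; have := c3c l (j, t) 1 u lt_u.
  rewrite muln1 -(c2s j l t) // => <-; apply: eq_card => e; rewrite !inE xpair_eqE.
    by case: (ci e == j); case: (c2 e == t); case: (si e == l).
  by case: (ci e == j); case: (c2 e == t); case: (si e == l).
have uniq_in (A : pred E) e e' : #|[pred e | A e]| = 1 -> A e -> A e' -> e = e'.
  move=> A1 Ae Ae'; have /card_le1_eqP : #|[pred e | A e]| <= 1 by rewrite A1.
  by apply.
have /fin_all_exists[cell' cellP'] (pq : {i : I & 'I_(w i)} * {i : I & 'I_(w i)}) :
    exists e, [&& ri e == tag pq.1, c1 e == tagged pq.1,
                  ci e == tag pq.2 & c2 e == tagged pq.2].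
  have /pred0Pn[e eP] : #|[pred e | [&& ri e == tag pq.1, c1 e == tagged pq.1,
      ci e == tag pq.2 & c2 e == tagged pq.2]]| != 0 by rewrite c2r.
  by exists e.
pose cell p q := cell' (p, q).
have cellP p q : [&& ri (cell p q) == tag p, c1 (cell p q) == tagged p,
    ci (cell p q) == tag q & c2 (cell p q) == tagged q] := cellP' (p, q).
exists (fun p q => Tagged (fun i => 'I_(w i)) (Ordinal (c3w (cell p q)))).
have pairP (p q : {i : I & 'I_(w i)}) : tag p = tag q ->
    nat_of_ord (tagged p) = nat_of_ord (tagged q) -> p = q.
  case: p q => [i u] [j v] /= e; case: _ / e v => v e; congr (Tagged _ _).
  exact: val_inj.
split.
- move=> p q q' eL; have /and4P[r1 r2 r3 r4] := cellP p q.
  have /and4P[r1' r2' r3' r4'] := cellP p q'.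
  have e : cell p q = cell p q'.
    apply: (uniq_in _ _ _ (c3r _ _ _ _ (ltn_ord (tagged p)) (c3w (cell p q)))).
      by rewrite r1 r2 !eqxx.
    rewrite r1' r2' /=.
    have /= [-> ->] := congr1 (fun p : {i : I & 'I_(w i)} =>
      (tag p, nat_of_ord (tagged p))) eL.
    by rewrite !eqxx.
  apply: pairP; first by rewrite -(eqP r3) e (eqP r3').
  by rewrite -(eqP r4) e (eqP r4').
- move=> q p p' eL; have /and4P[r1 r2 r3 r4] := cellP p q.
  have /and4P[r1' r2' r3' r4'] := cellP p' q.
  have e : cell p q = cell p' q.
    apply: (uniq_in _ _ _ (c3c _ _ _ _ (ltn_ord (tagged q)) (c3w (cell p q)))).
      by rewrite r3 r4 !eqxx.
    rewrite r3' r4' /=.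
    have /= [-> ->] := congr1 (fun p : {i : I & 'I_(w i)} =>
      (tag p, nat_of_ord (tagged p))) eL.
    by rewrite !eqxx.
  apply: pairP; first by rewrite -(eqP r1) e (eqP r1').
  by rewrite -(eqP r2) e (eqP r2').
move=> p q /=; have /and4P[/eqP r1 _ /eqP r3 _] := cellP p q.
rewrite -r1 -r3.
exact: leq_ltn_trans (leq0n _) (ltn_ord (tagged (cell p q))).
Qed.

Lemma latin_on_inj (n : nat) (L : 'M['I_n]_n) (A : {set 'I_n}) :
  (forall r, injective (L r)) -> (forall c, injective (L^~ c)) ->
  (forall r c, r \in A -> c \in A -> L r c \in A) -> latin_on L A A A.
Proof.
move=> Lr Lc LA.
have onto (f : 'I_n -> 'I_n) x : injective f -> {in A, forall c, f c \in A} ->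
    x \in A -> exists! c, c \in A /\ f c = x.
  move=> fI fA; have fAA : f @: A = A.
    apply/eqP; rewrite eqEcard card_imset // leqnn andbT.
    by apply/subsetP => _ /imsetP[c /fA fcA ->].
  by rewrite -{1}fAA => /imsetP[c cA ->]; exists c; split=> // c' [_ /fI].
split=> //.
  by move=> r x rA; apply: onto => // c; apply: LA.
by move=> c x cA; apply: (onto (L^~ c)) => // r rA; apply: LA.
Qed.

(** [part] may merge classes: below, a large part is a single class and a small one the union of its
    units. The last hypothesis makes the subarray of a part closed, and a closed subarray is a
    subsquare because rows and columns are injective. *)
Lemma realization_of_outline (P : seq nat) (I : finType) (w : I -> nat)
    (x : I -> I -> I -> nat) (part : I -> 'I_(size P)) :
  (forall p, p \in P -> 0 < p) -> (forall i, 0 < w i) ->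
  (forall i j, \sum_l x i j l = w i * w j) ->
  (forall i l, \sum_j x i j l = w i * w l) ->
  (forall j l, \sum_i x i j l = w j * w l) ->
  (forall g, \sum_(i | part i == g) w i = nth 0 P g) ->
  (forall i j l, 0 < x i j l -> part i = part j -> part l = part i) ->
  exists n (L : 'M['I_n]_n), realization P L.
Proof.
move=> P0 w0 x12 x13 x23 wP xP.
have [L0 [L0r L0c L0x]] := outline_latin w0 x12 x13 x23.
pose N : finType := {i : I & 'I_(w i)}.
pose L : 'M['I_#|N|]_#|N| :=
  (\matrix_(r, c) enum_rank (L0 (enum_val r) (enum_val c)))%R.
have Lr r : injective (L r).
  by move=> c c'; rewrite !mxE => /enum_rank_inj/L0r/enum_val_inj.
have Lc c : injective (L^~ c).
  by move=> r r'; rewrite !mxE => /enum_rank_inj/L0c/enum_val_inj.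
pose A g : {set 'I_#|N|} := [set r | part (tag (enum_val r)) == g].
have cardA g : #|A g| = nth 0 P g.
  rewrite -wP -(card_tagged_ord w (fun i => part i == g)).
  rewrite -(card_imset _ (@enum_val_inj N N)); apply: eq_card => p; rewrite !inE.
  apply/imsetP/idP => [[r + ->]|pg]; first by rewrite inE.
  by exists (enum_rank p); rewrite ?inE enum_rankK.
exists #|N|, L; split.
- split=> //; transitivity (\sum_i w i); last first.
    by rewrite -(card_tagged_ord w xpredT); apply: eq_card.
  rewrite (partition_big part xpredT) //= (eq_bigr _ (fun g _ => wP g)).
  by rewrite sumnE (big_nth 0) big_mkord.
- by apply: latin_on_inj => // r c _ _; apply: in_setT.
exists A, A, A; split.
  move=> g; split; first exact: cardA.
  apply: latin_on_inj => // r c; rewrite !inE => /eqP pr /eqP pc.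
  rewrite mxE enum_rankK -pr; apply/eqP.
  by apply: xP (L0x _ _) _; rewrite pr pc.
have dis g g' : g != g' -> [disjoint A g & A g'].
  move=> ngg'; apply/pred0P => r; rewrite !inE.
  by case: eqP => //= ->; apply/negbTE.
by move=> g g' /dis.
Qed.

(** * Outlines with three large parts *)

Notation o0 := (@Ordinal 3 0 isT).
Notation o1 := (@Ordinal 3 1 isT).
Notation o2 := (@Ordinal 3 2 isT).

Lemma ord3P (Q : 'I_3 -> Prop) : Q o0 -> Q o1 -> Q o2 -> forall i, Q i.
Proof.
move=> Q0 Q1 Q2 [[|[|[|]]] lt_i] //; by rewrite (bool_irrelevance lt_i isT).
Qed.

Lemma sum_ord3 (F : 'I_3 -> nat) : \sum_i F i = F o0 + F o1 + F o2.
Proof.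
rewrite !big_ord_recl big_ord0 addn0 addnA.
by congr (F _ + F _ + F _); apply: val_inj.
Qed.

Definition ord3_eqE := (erefl : (o0 == o0) = true, erefl : (o1 == o1) = true,
  erefl : (o2 == o2) = true, erefl : (o0 == o1) = false, erefl : (o0 == o2) = false,
  erefl : (o1 == o0) = false, erefl : (o1 == o2) = false, erefl : (o2 == o0) = false,
  erefl : (o2 == o1) = false).

Definition distinct3 (i j k : 'I_3) := [&& i != j, j != k & i != k].

(* The digits in E12, E13, E23 are the positions (1 = row, 2 = column, 3 = symbol)
   of the units: E12 u v k is the weight of (unit u, unit v, part k),
   while r, c and t have a single unit, as row, column and symbol respectively. *)
Section Assembly.
Variables (U : finType) (a : nat) (T : U -> U -> U -> nat)
  (E12 E13 E23 : U -> U -> 'I_3 -> nat) (r c t : U -> 'I_3 -> 'I_3 -> nat)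
  (q : 'I_3 -> 'I_3 -> 'I_3 -> nat).

Definition center (i j k : 'I_3) : nat :=
  if (i == j) && (j == k) then a * a
  else if distinct3 i j k then a * a - q i j k else 0.

Definition glue (x y z : U + 'I_3) : nat :=
  match x, y, z with
  | inl u, inl v, inl w => T u v w
  | inl u, inl v, inr k => E12 u v k
  | inl u, inr j, inl w => E13 u w j
  | inr i, inl v, inl w => E23 v w i
  | inl u, inr j, inr k => r u j k
  | inr i, inl v, inr k => c v i k
  | inr i, inr j, inl w => t w i j
  | inr i, inr j, inr k => center i j k
  end.

Definition glue_weight (x : U + 'I_3) : nat := if x is inl _ then 1 else a.

Hypothesis TE12 : forall u v, \sum_w T u v w + \sum_k E12 u v k = 1.
Hypothesis TE13 : forall u w, \sum_v T u v w + \sum_k E13 u w k = 1.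
Hypothesis TE23 : forall v w, \sum_u T u v w + \sum_k E23 v w k = 1.
Hypothesis rE13 : forall u j, \sum_w E13 u w j + \sum_k r u j k = a.
Hypothesis rE12 : forall u k, \sum_v E12 u v k + \sum_j r u j k = a.
Hypothesis cE23 : forall v i, \sum_w E23 v w i + \sum_k c v i k = a.
Hypothesis cE12 : forall v k, \sum_u E12 u v k + \sum_i c v i k = a.
Hypothesis tE23 : forall w i, \sum_v E23 v w i + \sum_j t w i j = a.
Hypothesis tE13 : forall w j, \sum_u E13 u w j + \sum_i t w i j = a.
Hypothesis rct0 : forall u i, [/\ r u i i = 0, c u i i = 0 & t u i i = 0].
Hypothesis qP : forall i j k, distinct3 i j k ->
  [/\ \sum_w t w i j = q i j k, \sum_v c v i k = q i j k,
      \sum_u r u j k = q i j k & q i j k <= a * a].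

Lemma glue_latin :
  [/\ forall x y, \sum_z glue x y z = glue_weight x * glue_weight y,
      forall x z, \sum_y glue x y z = glue_weight x * glue_weight z &
      forall y z, \sum_x glue x y z = glue_weight y * glue_weight z].
Proof.
have rd i : \sum_u r u i i = 0 by apply: big1 => u _; case: (rct0 u i).
have cd i : \sum_u c u i i = 0 by apply: big1 => u _; case: (rct0 u i).
have td i : \sum_u t u i i = 0 by apply: big1 => u _; case: (rct0 u i).
have [t01 c02 r12 q012] := qP (isT : distinct3 o0 o1 o2).
have [t02 c01 r21 q021] := qP (isT : distinct3 o0 o2 o1).
have [t10 c12 r02 q102] := qP (isT : distinct3 o1 o0 o2).
have [t12 c10 r20 q120] := qP (isT : distinct3 o1 o2 o0).
have [t20 c21 r01 q201] := qP (isT : distinct3 o2 o0 o1).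
have [t21 c20 r10 q210] := qP (isT : distinct3 o2 o1 o0).
split; move=> [u|i] [v|j]; rewrite big_sumType /= ?mul1n ?muln1 //;
  elim/ord3P: i; elim/ord3P: j; rewrite sum_ord3 /center /distinct3 !ord3_eqE /=
    ?rd ?cd ?td ?t01 ?t02 ?t10 ?t12 ?t20 ?t21 ?c01 ?c02 ?c10 ?c12 ?c20 ?c21
    ?r01 ?r02 ?r10 ?r12 ?r20 ?r21 ?add0n ?addn0 ?subnKC //.
Qed.
End Assembly.

(* T can be completed to an outline square on the units (weight 1) and three
   large parts (weight a) in which the large parts span subsquares. *)
Definition outline_over (U : finType) (a : nat) (T : U -> U -> U -> nat) : Prop :=
  exists x : U + 'I_3 -> U + 'I_3 -> U + 'I_3 -> nat,
    [/\ forall y z, \sum_t x y z t = glue_weight a y * glue_weight a z,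
        forall y t, \sum_z x y z t = glue_weight a y * glue_weight a t,
        forall z t, \sum_y x y z t = glue_weight a z * glue_weight a t,
        forall u v w, x (inl u) (inl v) (inl w) = T u v w &
        forall i t, 0 < x (inr i) (inr i) t -> t = inr i].

Lemma outline_over_glue (U : finType) (a : nat) (T : U -> U -> U -> nat)
    (E12 E13 E23 : U -> U -> 'I_3 -> nat) (r c t : U -> 'I_3 -> 'I_3 -> nat) :
  (forall u v, \sum_w T u v w + \sum_k E12 u v k = 1) ->
  (forall u w, \sum_v T u v w + \sum_k E13 u w k = 1) ->
  (forall v w, \sum_u T u v w + \sum_k E23 v w k = 1) ->
  (forall u j, \sum_w E13 u w j + \sum_k r u j k = a) ->
  (forall u k, \sum_v E12 u v k + \sum_j r u j k = a) ->
  (forall v i, \sum_w E23 v w i + \sum_k c v i k = a) ->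
  (forall v k, \sum_u E12 u v k + \sum_i c v i k = a) ->
  (forall w i, \sum_v E23 v w i + \sum_j t w i j = a) ->
  (forall w j, \sum_u E13 u w j + \sum_i t w i j = a) ->
  (forall u i, [/\ r u i i = 0, c u i i = 0 & t u i i = 0]) ->
  (forall i j k, distinct3 i j k ->
    [/\ \sum_v c v i k = \sum_w t w i j, \sum_u r u j k = \sum_w t w i j &
        \sum_w t w i j <= a * a]) ->
  outline_over a T.
Proof.
move=> h1 h2 h3 h4 h5 h6 h7 h8 h9 rct0 qP.
pose q i j (k : 'I_3) := \sum_w t w i j.
have {}qP i j k (d : distinct3 i j k) : [/\ \sum_w t w i j = q i j k,
    \sum_v c v i k = q i j k, \sum_u r u j k = q i j k & q i j k <= a * a].
  by have [? ? ?] := qP i j k d.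
have [x12 x13 x23] := glue_latin h1 h2 h3 h4 h5 h6 h7 h8 h9 rct0 qP.
exists (glue a T E12 E13 E23 r c t q); split=> // i [w|k] /=.
  by have [_ _ ->] := rct0 w i.
rewrite /center eqxx /=; case: eqP => [->//|_].
by rewrite /distinct3 eqxx.
Qed.

Lemma sum_bool (T : finType) (P : pred T) : \sum_x (P x : nat) = #|[pred x | P x]|.
Proof.
rewrite -sum1_card [RHS]big_mkcond /=; apply: eq_bigr => x _.
by rewrite inE; case: (P x).
Qed.

Lemma balanced_kernel (T : finType) (X : eqType) (c S : pred T) (l : T -> X) (x : X) :
  [forall e, balanced c (fun y => kernel l e y && S y)] ->
  (\sum_y ((l y == x) && (S y && c y) : nat) <=
    (\sum_y ((l y == x) && (S y && ~~ c y) : nat)).+1) &&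
  (\sum_y ((l y == x) && (S y && ~~ c y) : nat) <=
    (\sum_y ((l y == x) && (S y && c y) : nat)).+1).
Proof.
move/forallP=> bal; case: (pickP [pred e | l e == x]) => [e /= /eqP <-|none].
  have := bal e; rewrite /balanced !sum_bool.
  congr ((_ <= _.+1) && (_ <= _.+1)); apply: eq_card => y;
    by rewrite !inE /kernel (eq_sym (l e)) andbA.
by rewrite !big1 // => y _; have /= -> := none y.
Qed.

Lemma kernel_factor (T : Type) (X Y : eqType) (l : T -> X) (l' : T -> Y) (g : X -> Y) :
  (forall e, l' e = g (l e)) -> subrel (kernel l) (kernel l').
Proof. by move=> lE x y /eqP e; rewrite /kernel !lE e. Qed.

(** * Balanced sharing of the uncovered pairs *)

Section Edges.
Variable U : finType.
Implicit Types (P K : U -> U -> bool).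

(** The tag tells the relation a pair belongs to; with all relations in one type, a single colouring
    can balance degrees summed over two or three of them. *)
Definition edge : finType := ('I_3 * (U * U))%type.

Lemma sum_edges (G : edge -> nat) : \sum_e G e =
  \sum_x \sum_y G (o0, (x, y)) + \sum_x \sum_y G (o1, (x, y)) +
  \sum_x \sum_y G (o2, (x, y)).
Proof.
transitivity (\sum_i \sum_p G (i, p)); first by rewrite pair_big; apply: eq_bigr => -[].
rewrite sum_ord3; congr (_ + _ + _); rewrite pair_big; apply: eq_bigr => -[] //.
Qed.

Lemma sum_row P u : \sum_x \sum_y ((x == u) && P x y : nat) = \sum_y (P u y : nat).
Proof.
rewrite (bigD1 u) //= [X in _ + X]big1 ?addn0 => [|x nx]; last first.
  by apply: big1 => y _; rewrite (negPf nx).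
by rewrite eqxx.
Qed.

Lemma sum_col P u : \sum_x \sum_y ((y == u) && P x y : nat) = \sum_x (P x u : nat).
Proof. by rewrite exchange_big; apply: (sum_row (fun x y => P y x)). Qed.

Lemma sum_tagged_row (X : eqType) (i j : X) P u : i = j ->
  \sum_x \sum_y (((i, x) == (j, u)) && P x y : nat) = \sum_y (P u y : nat).
Proof.
by move=> ->; rewrite -sum_row; do 2!apply: eq_bigr => ? _; rewrite xpair_eqE eqxx.
Qed.

Lemma sum_tagged_col (X : eqType) (i j : X) P u : i = j ->
  \sum_x \sum_y (((i, y) == (j, u)) && P x y : nat) = \sum_x (P x u : nat).
Proof.
by move=> ->; rewrite -sum_col; do 2!apply: eq_bigr => ? _; rewrite xpair_eqE eqxx.
Qed.

Definition near m n := (m <= n.+1) && (n <= m.+1).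
Definition rdeg P u := \sum_v (P u v : nat).
Definition cdeg P v := \sum_u (P u v : nat).
Definition edge_count P := \sum_u \sum_v (P u v : nat).

(** The left chain groups pairs by symbol, in each relation and then jointly; the right chain groups
    them by first endpoint and then by relation. The joint balance at a symbol becomes an equality
    when the total is even, as in the application. *)
Lemma two_relation_coloring K13 K23 :
  exists c d : bool -> U -> U -> bool,
    [/\ forall u w, c true u w + c false u w = K13 u w,
        forall v w, d true v w + d false v w = K23 v w &
     [/\
      forall w, [/\ near (cdeg (c true) w) (cdeg (c false) w),
        near (cdeg (d true) w) (cdeg (d false) w) &
        near (cdeg (c true) w + cdeg (d true) w) (cdeg (c false) w + cdeg (d false) w)],
      forall u, near (rdeg (c true) u) (rdeg (c false) u) /\
        near (rdeg (d true) u) (rdeg (d false) u),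
      near (edge_count (c true)) (edge_count (c false)) &
      near (edge_count (d true)) (edge_count (d false))]].
Proof.
pose S (e : edge) := if e.1 == o0 then false
  else if e.1 == o1 then K13 e.2.1 e.2.2 else K23 e.2.1 e.2.2.
pose l1 (e : edge) := (e.1, e.2.2).
pose l2 (e : edge) := e.2.2.
pose r1 (e : edge) := (e.1, e.2.1).
pose r2 (e : edge) := e.1.
have chL : chain eq_op [:: kernel l1; kernel l2].
  split; [exact: kernel_equiv | exact: sub_kernel_eq | split=> //].
    exact: kernel_equiv.
  exact: (kernel_factor (g := snd)).
have chR : chain eq_op [:: kernel r1; kernel r2].
  split; [exact: kernel_equiv | exact: sub_kernel_eq | split=> //].
    exact: kernel_equiv.
  exact: (kernel_factor (g := fst)).
have [col /and5P[bl1 bl2 br1 br2 _]] := laminar_2coloring_on S chL chR.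
exists (fun b u w => K13 u w && (if b then col (o1, (u, w)) else ~~ col (o1, (u, w)))),
       (fun b v w => K23 v w && (if b then col (o2, (v, w)) else ~~ col (o2, (v, w)))).
have s0 : \sum_(x : U) \sum_(y : U) 0 = 0 by apply: big1 => x _; apply: big1.
split=> [u w|v w|].
- by case: (K13 u w); case: (col _).
- by case: (K23 v w); case: (col _).
split=> [w|u||].
- split.
  + have := balanced_kernel (o1, w) bl1; rewrite !sum_edges /S /l1 /=.
    by rewrite !s0 ?add0n ?addn0 ?sum_col ?sum_tagged_col.
  + have := balanced_kernel (o2, w) bl1; rewrite !sum_edges /S /l1 /=.
    by rewrite !s0 ?add0n ?addn0 ?sum_col ?sum_tagged_col.
  have := balanced_kernel w bl2; rewrite !sum_edges /S /l2 /= ?andbF /=.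
  by rewrite !sum_col /= !big1_eq !add0n.
- split.
  + have := balanced_kernel (o1, u) br1; rewrite !sum_edges /S /r1 /=.
    by rewrite !s0 ?add0n ?addn0 ?sum_row ?sum_tagged_row.
  have := balanced_kernel (o2, u) br1; rewrite !sum_edges /S /r1 /=.
  by rewrite !s0 ?add0n ?addn0 ?sum_row ?sum_tagged_row.
- have := balanced_kernel o1 br2; rewrite !sum_edges /S /r2 /=.
  by rewrite !s0 ?add0n ?addn0.
have := balanced_kernel o2 br2; rewrite !sum_edges /S /r2 /=.
by rewrite !s0 ?add0n ?addn0.
Qed.

(* K12, K13, K23 carry the tags o0, o1, o2.  The left chain merges the row classes of
   K12 and K13, the right chain the column classes of K12 and K23; each chain sees
   the symbol classes of the third relation. *)
Lemma three_relation_coloring K12 K13 K23 :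
  exists b c d : bool -> U -> U -> bool,
    [/\ forall u v, b true u v + b false u v = K12 u v,
        forall u w, c true u w + c false u w = K13 u w,
        forall v w, d true v w + d false v w = K23 v w &
     [/\ forall u, [/\ near (rdeg (b true) u) (rdeg (b false) u),
          near (rdeg (c true) u) (rdeg (c false) u) &
          near (rdeg (b true) u + rdeg (c true) u) (rdeg (b false) u + rdeg (c false) u)],
        forall v, [/\ near (cdeg (b true) v) (cdeg (b false) v),
          near (rdeg (d true) v) (rdeg (d false) v) &
          near (cdeg (b true) v + rdeg (d true) v) (cdeg (b false) v + rdeg (d false) v)],
        forall w, near (cdeg (c true) w) (cdeg (c false) w) /\
          near (cdeg (d true) w) (cdeg (d false) w) &
        [/\ near (edge_count (c true)) (edge_count (c false)),
            near (edge_count (d true)) (edge_count (d false)) &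
            near (edge_count (b true) + edge_count (c true) + edge_count (d true))
                 (edge_count (b false) + edge_count (c false) + edge_count (d false))]]].
Proof.
pose S (e : edge) := if e.1 == o0 then K12 e.2.1 e.2.2
  else if e.1 == o1 then K13 e.2.1 e.2.2 else K23 e.2.1 e.2.2.
pose l1 (e : edge) := (e.1, if e.1 == o2 then e.2.2 else e.2.1).
pose l2 (e : edge) := (e.1 == o2, if e.1 == o2 then e.2.2 else e.2.1).
pose l3 (e : edge) := e.1 == o2.
pose l4 (e : edge) := true.
pose r1 (e : edge) := (e.1, if e.1 == o2 then e.2.1 else e.2.2).
pose r2 (e : edge) := (e.1 == o1, if e.1 == o2 then e.2.1 else e.2.2).
pose r3 (e : edge) := e.1 == o1.
have chL : chain eq_op [:: kernel l1; kernel l2; kernel l3; kernel l4].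
  split; [exact: kernel_equiv | exact: sub_kernel_eq |].
  split; [exact: kernel_equiv | exact: (kernel_factor (g := fun p => (p.1 == o2, p.2))) |].
  split; [exact: kernel_equiv | exact: (kernel_factor (g := fst)) |].
  by split; [exact: kernel_equiv | exact: (kernel_factor (g := xpredT)) |].
have chR : chain eq_op [:: kernel r1; kernel r2; kernel r3].
  split; [exact: kernel_equiv | exact: sub_kernel_eq |].
  split; [exact: kernel_equiv | exact: (kernel_factor (g := fun p => (p.1 == o1, p.2))) |].
  by split; [exact: kernel_equiv | exact: (kernel_factor (g := fst)) |].
have [col /and5P[bl1 bl2 bl3 bl4 /and4P[br1 br2 br3 _]]] := laminar_2coloring_on S chL chR.
pose cut (K : U -> U -> bool) i a u v :=
  K u v && (if a then col (i, (u, v)) else ~~ col (i, (u, v))).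
have cutP (K : U -> U -> bool) i u v : cut K i true u v + cut K i false u v = K u v.
  by rewrite /cut; case: (K u v); case: (col _).
exists (cut K12 o0), (cut K13 o1), (cut K23 o2); split; try exact: cutP.
have s0 : \sum_(x : U) \sum_(y : U) 0 = 0 by apply: big1 => x _; apply: big1.
split=> [u|v|w|].
- split.
  + have := balanced_kernel (o0, u) bl1; rewrite !sum_edges /S /l1 /=.
    by rewrite !s0 ?add0n ?addn0 ?sum_row ?sum_tagged_row.
  + have := balanced_kernel (o1, u) bl1; rewrite !sum_edges /S /l1 /=.
    by rewrite !s0 ?add0n ?addn0 ?sum_row ?sum_tagged_row.
  have := balanced_kernel (false, u) bl2; rewrite !sum_edges /S /l2 /=.
  by rewrite !s0 ?add0n ?addn0 !ord3_eqE !sum_tagged_row.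
- split.
  + have := balanced_kernel (o0, v) br1; rewrite !sum_edges /S /r1 /=.
    by rewrite !s0 ?add0n ?addn0 ?sum_tagged_col.
  + have := balanced_kernel (o2, v) br1; rewrite !sum_edges /S /r1 /=.
    by rewrite !s0 ?add0n ?addn0 ?sum_tagged_row.
  have := balanced_kernel (false, v) br2; rewrite !sum_edges /S /r2 /=.
  rewrite !s0 ?add0n ?addn0 !ord3_eqE !sum_tagged_row //.
  rewrite !(sum_tagged_col (fun x y => K12 x y && col (o0, (x, y))) v (erefl false)).
  by rewrite !(sum_tagged_col (fun x y => K12 x y && ~~ col (o0, (x, y))) v (erefl false)).
- split.
  + have := balanced_kernel (o1, w) br1; rewrite !sum_edges /S /r1 /=.
    by rewrite !s0 ?add0n ?addn0 ?sum_tagged_col.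
  have := balanced_kernel (o2, w) bl1; rewrite !sum_edges /S /l1 /=.
  by rewrite !s0 ?add0n ?addn0 ?sum_tagged_col.
split.
- have := balanced_kernel true br3; rewrite !sum_edges /S /r3 /=.
  by rewrite !s0 ?add0n ?addn0.
- have := balanced_kernel true bl3; rewrite !sum_edges /S /l3 /=.
  by rewrite !s0 ?add0n ?addn0.
by have := balanced_kernel true bl4; rewrite !sum_edges /S /l4 /=.
Qed.
End Edges.

Definition sel3 (S : Type) (x0 x1 x2 : S) (k : 'I_3) : S :=
  if k == o0 then x0 else if k == o1 then x1 else x2.

Section Degrees.
Variable U : finType.
Implicit Types P Q S : U -> U -> bool.

Lemma rdeg_add P Q S u :
  (forall v, P u v + Q u v = S u v :> nat) -> rdeg P u + rdeg Q u = rdeg S u.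
Proof. by move=> e; rewrite /rdeg -big_split; apply: eq_bigr => v _; apply: e. Qed.

Lemma cdeg_add P Q S v :
  (forall u, P u v + Q u v = S u v :> nat) -> cdeg P v + cdeg Q v = cdeg S v.
Proof. by move=> e; rewrite /cdeg -big_split; apply: eq_bigr => u _; apply: e. Qed.

Lemma edge_count_cdeg P : edge_count P = \sum_v cdeg P v. Proof. exact: exchange_big. Qed.

Lemma sum_defect (a : nat) (F : U -> nat) :
  (forall u, F u <= a) -> \sum_u (a - F u) + \sum_u F u = a * #|U|.
Proof.
move=> Fa; rewrite -big_split -sum1_card big_distrr /=; apply: eq_bigr => u _.
by rewrite muln1 subnK.
Qed.
End Degrees.

(** A1 > C2 would force equal odd sums with A1 = A2 + 1 and C1 = C2 + 1, which the third [near]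
    excludes; likewise for A2 and C1. The A are shares of row-column degrees, the C of degrees
    towards symbols. *)
Lemma defect_exchange (A1 A2 C1 C2 a : nat) :
  near A1 A2 -> near C1 C2 -> near (A1 + C1) (A2 + C2) ->
  A1 + A2 <= C1 + C2 -> C1 + C2 <= 2 * a ->
  [/\ A1 <= a, A2 <= a, C1 <= a, C2 <= a & (A1 <= C2) /\ (A2 <= C1)].
Proof. by rewrite /near => *; do ?split; lia. Qed.

(** * Large partial squares *)

Section SparseEmbedding.
Variables (U : finType) (a : nat) (T : U -> U -> U -> bool).
Variables (R12 R13 R23 : U -> U -> bool).
Let N1 u := \sum_v \sum_w (T u v w : nat).
Let N2 v := \sum_u \sum_w (T u v w : nat).
Let N3 w := \sum_u \sum_v (T u v w : nat).
Hypothesis T12 : forall u v, \sum_w (T u v w : nat) <= 1.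
Hypothesis T13 : forall u w, \sum_v (T u v w : nat) <= 1.
Hypothesis T23 : forall v w, \sum_u (T u v w : nat) <= 1.
Hypothesis N1_ge : forall u, #|U| <= N1 u + 3 * a.
Hypothesis N2_ge : forall v, #|U| <= N2 v + 3 * a.
Hypothesis N3_ge : forall w, #|U| <= N3 w + 3 * a.
Hypothesis T_size : \sum_u N1 u + 3 * a * #|U| <= 4 * (a * a) + #|U| * #|U|.
Hypothesis R12r : forall u, rdeg R12 u = a.
Hypothesis R12c : forall v, cdeg R12 v = a.
Hypothesis R13r : forall u, rdeg R13 u = a.
Hypothesis R13c : forall w, cdeg R13 w = a.
Hypothesis R23r : forall v, rdeg R23 v = a.
Hypothesis R23c : forall w, cdeg R23 w = a.
Hypothesis R12T : forall u v, R12 u v -> \sum_w (T u v w : nat) = 0.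
Hypothesis R13T : forall u w, R13 u w -> \sum_v (T u v w : nat) = 0.
Hypothesis R23T : forall v w, R23 v w -> \sum_u (T u v w : nat) = 0.

(* Stage 1 (e, f) cuts out the pairs given to the large part 0, leaving degree at
   most 2a; stage 2 (b, c, d) shares the rest between the parts 1 and 2.  Part 0
   receives R12 from the row-column pairs, while R13 and R23 are kept for stage 2.
   The defects that remain are then forced to be the entries of r, cc, t. *)
Lemma sparse_embedding : outline_over a (fun u v w => T u v w : nat).
Proof.
pose D12 u v := \sum_w (T u v w : nat) == 0.
pose D13 u w := \sum_v (T u v w : nat) == 0.
pose D23 v w := \sum_u (T u v w : nat) == 0.
have D12E u v : \sum_w (T u v w : nat) + D12 u v = 1.
  by rewrite /D12; case: (\sum_w _) (T12 u v) => [|[|]].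
have D13E u w : \sum_v (T u v w : nat) + D13 u w = 1.
  by rewrite /D13; case: (\sum_v _) (T13 u w) => [|[|]].
have D23E v w : \sum_u (T u v w : nat) + D23 v w = 1.
  by rewrite /D23; case: (\sum_u _) (T23 v w) => [|[|]].
have sum1U : \sum_(u : U) 1 = #|U| by rewrite sum1_card.
have dD12 u : N1 u + rdeg D12 u = #|U|.
  by rewrite -sum1U -big_split; apply: eq_bigr => v _; apply: D12E.
have dD13 u : N1 u + rdeg D13 u = #|U|.
  by rewrite /N1 exchange_big -sum1U -big_split; apply: eq_bigr => v _; apply: D13E.
have dD12' v : N2 v + cdeg D12 v = #|U|.
  by rewrite -sum1U -big_split; apply: eq_bigr => u _; apply: D12E.
have dD23 v : N2 v + rdeg D23 v = #|U|.
  by rewrite /N2 exchange_big -sum1U -big_split; apply: eq_bigr => w _; apply: D23E.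
have dD13' w : N3 w + cdeg D13 w = #|U|.
  by rewrite -sum1U -big_split; apply: eq_bigr => u _; apply: D13E.
have dD23' w : N3 w + cdeg D23 w = #|U|.
  by rewrite /N3 exchange_big -sum1U -big_split; apply: eq_bigr => v _; apply: D23E.
have without (D R : U -> U -> bool) : (forall u v, R u v -> D u v) ->
    forall u v, (R u v : nat) + (D u v && ~~ R u v) = D u v.
  by move=> RD u v; case: (R u v) (RD u v) => [->|] //; rewrite andbT.
pose H12 u v := D12 u v && ~~ R12 u v.
pose H13 u v := D13 u v && ~~ R13 u v.
pose H23 u v := D23 u v && ~~ R23 u v.
have H12E : forall u v, R12 u v + H12 u v = D12 u v.
  by apply: without => u v /R12T/eqP.
have H13E : forall u v, R13 u v + H13 u v = D13 u v.
  by apply: without => u v /R13T/eqP.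
have H23E : forall u v, R23 u v + H23 u v = D23 u v.
  by apply: without => u v /R23T/eqP.
have [e [f [eE fE [ef_w ef_u e_size f_size]]]] := two_relation_coloring H13 H23.
pose K13 u w := D13 u w && ~~ e true u w.
pose K23 v w := D23 v w && ~~ f true v w.
have K13E : forall u w, e true u w + K13 u w = D13 u w.
  apply: without => u w euw; move: (eE u w); rewrite euw /H13.
  by case: (D13 u w).
have K23E : forall v w, f true v w + K23 v w = D23 v w.
  apply: without => v w fvw; move: (fE v w); rewrite fvw /H23.
  by case: (D23 v w).
have [b [c [d [bE cE dE [bc bd cd [c_size d_size bcd_size]]]]]] :=
  three_relation_coloring H12 K13 K23.
have unit_row u :
  [/\ rdeg (e true) u + rdeg (c true) u + rdeg (c false) u =
        a + rdeg (b true) u + rdeg (b false) u &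
      [/\ rdeg (b true) u <= a, rdeg (b false) u <= a,
          rdeg (c true) u <= a, rdeg (c false) u <= a &
          rdeg (b true) u <= rdeg (c false) u /\ rdeg (b false) u <= rdeg (c true) u]].
  have := dD12 u; have := dD13 u; have := N1_ge u.
  have := rdeg_add (fun v => H12E u v); have := rdeg_add (fun v => H13E u v).
  have := rdeg_add (fun v => eE u v); have := rdeg_add (fun v => K13E u v).
  have := rdeg_add (fun v => bE u v); have := rdeg_add (fun v => cE u v).
  have := R12r u; have := R13r u.
  have [n1 n2 n3] := bc u; have [+ _] := ef_u u; rewrite {1}/near => n4.
  move: n1 n2 n3 n4; clear => *; split; first lia.
  apply: defect_exchange => //; lia.
have unit_col v :
  [/\ rdeg (f true) v + rdeg (d true) v + rdeg (d false) v =
        a + cdeg (b true) v + cdeg (b false) v &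
      [/\ cdeg (b true) v <= a, cdeg (b false) v <= a,
          rdeg (d true) v <= a, rdeg (d false) v <= a &
          cdeg (b true) v <= rdeg (d false) v /\ cdeg (b false) v <= rdeg (d true) v]].
  have := dD12' v; have := dD23 v; have := N2_ge v.
  have := cdeg_add (fun u => H12E u v); have := rdeg_add (fun w => H23E v w).
  have := rdeg_add (fun w => fE v w); have := rdeg_add (fun w => K23E v w).
  have := cdeg_add (fun u => bE u v); have := rdeg_add (fun w => dE v w).
  have := R12c v; have := R23r v.
  have [n1 n2 n3] := bd v; have [_ +] := ef_u v; rewrite {1}/near => n4.
  move: n1 n2 n3 n4; clear => *; split; first lia.
  apply: defect_exchange => //; lia.
have edge_count_add (P Q S : U -> U -> bool) :
    (forall u v, P u v + Q u v = S u v :> nat) -> edge_count P + edge_count Q = edge_count S.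
  by move=> PQ; rewrite -big_split; apply: eq_bigr => u _; apply: rdeg_add.
(* [H13] and [H23] have the same degree at w, so the joint total of [e] and [f] is even and their
   joint balance is an equality. *)
have unit_sym w :
  [/\ cdeg (c true) w <= a, cdeg (c false) w <= a,
      cdeg (d true) w <= a, cdeg (d false) w <= a &
      cdeg (c true) w + cdeg (c false) w = cdeg (f true) w + a /\
      cdeg (d true) w + cdeg (d false) w = cdeg (e true) w + a /\
      cdeg (e true) w + cdeg (f true) w + a = cdeg D13 w].
  have := dD13' w; have := dD23' w; have := N3_ge w.
  have := cdeg_add (fun u => H13E u w); have := cdeg_add (fun u => H23E u w).
  have := cdeg_add (fun u => eE u w); have := cdeg_add (fun u => fE u w).
  have := cdeg_add (fun u => K13E u w); have := cdeg_add (fun u => K23E u w).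
  have := cdeg_add (fun u => cE u w); have := cdeg_add (fun u => dE u w).
  have [n1 n2 n3] := ef_w w; have [n4 n5] := cd w; have := R13c w; have := R23c w.
  move: n1 n2 n3 n4 n5; rewrite /near; clear=> *; split; lia.
pose rc (A1 A2 C1 C2 : nat) (j k : 'I_3) : nat :=
  sel3 (sel3 0 (C2 - A1) (C1 - A2) k) (sel3 0 0 (a - C1) k) (sel3 0 (a - C2) 0 k) j.
pose r u := rc (rdeg (b true) u) (rdeg (b false) u) (rdeg (c true) u) (rdeg (c false) u).
pose cc v := rc (cdeg (b true) v) (cdeg (b false) v) (rdeg (d true) v) (rdeg (d false) v).
pose t w (i j : 'I_3) : nat := sel3
  (sel3 0 (a - cdeg (c true) w) (a - cdeg (c false) w) j)
  (sel3 (a - cdeg (d true) w) 0 0 j) (sel3 (a - cdeg (d false) w) 0 0 j) i.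
pose E12 u v (k : 'I_3) : nat := sel3 (R12 u v) (b true u v) (b false u v) k.
pose E13 u v (k : 'I_3) : nat := sel3 (e true u v) (c true u v) (c false u v) k.
pose E23 u v (k : 'I_3) : nat := sel3 (f true u v) (d true u v) (d false u v) k.
apply: (outline_over_glue (E12 := E12) (E13 := E13) (E23 := E23) (r := r) (c := cc) (t := t)).
- move=> u v; rewrite sum_ord3 /E12 /sel3 !ord3_eqE.
  by have := D12E u v; have := H12E u v; have := bE u v; clear; lia.
- move=> u w; rewrite sum_ord3 /E13 /sel3 !ord3_eqE.
  by have := D13E u w; have := K13E u w; have := cE u w; clear; lia.
- move=> v w; rewrite sum_ord3 /E23 /sel3 !ord3_eqE.
  by have := D23E v w; have := K23E v w; have := dE v w; clear; lia.
- move=> u; have [e1 [h1 h2 h3 h4 [h5 h6]]] := unit_row u.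
  elim/ord3P; rewrite sum_ord3 /E13 /r /rc /sel3 !ord3_eqE -/(rdeg _ u); lia.
- move=> u; have [e1 [h1 h2 h3 h4 [h5 h6]]] := unit_row u.
  elim/ord3P; rewrite sum_ord3 /E12 /r /rc /sel3 !ord3_eqE -/(rdeg _ u) ?R12r; lia.
- move=> u; have [e1 [h1 h2 h3 h4 [h5 h6]]] := unit_col u.
  elim/ord3P; rewrite sum_ord3 /E23 /cc /rc /sel3 !ord3_eqE -/(rdeg _ u); lia.
- move=> u; have [e1 [h1 h2 h3 h4 [h5 h6]]] := unit_col u.
  elim/ord3P; rewrite sum_ord3 /E12 /cc /rc /sel3 !ord3_eqE -/(cdeg _ u) ?R12c; lia.
- move=> w; have [h1 h2 h3 h4 [h5 [h6 _]]] := unit_sym w.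
  elim/ord3P; rewrite sum_ord3 /E23 /t /sel3 !ord3_eqE -/(cdeg _ w); lia.
- move=> w; have [h1 h2 h3 h4 [h5 [h6 _]]] := unit_sym w.
  elim/ord3P; rewrite sum_ord3 /E13 /t /sel3 !ord3_eqE -/(cdeg _ w); lia.
- by move=> u; elim/ord3P; rewrite /r /cc /t /rc /sel3 !ord3_eqE.
have sumsU (F : U -> nat) n : (forall u, F u = n) -> \sum_u F u = n * #|U|.
  by move=> Fn; rewrite (eq_bigr (fun=> n)) // sum_nat_const mulnC.
have sD12 : \sum_u N1 u + edge_count D12 = #|U| * #|U|.
  by rewrite -big_split; apply: sumsU => u; apply: dD12.
have sD13 : \sum_u N1 u + edge_count D13 = #|U| * #|U|.
  by rewrite -big_split; apply: sumsU => u; apply: dD13.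
have sD23 : edge_count D23 = edge_count D12.
  rewrite [RHS]edge_count_cdeg; apply: eq_bigr => v _.
  by apply/eqP; rewrite -(eqn_add2l (N2 v)) (dD12' v) (dD23 v).
have sR12 : edge_count R12 = a * #|U| by apply: sumsU.
have sR13 : edge_count R13 = a * #|U| by apply: sumsU.
have sR23 : edge_count R23 = a * #|U| by apply: sumsU.
have sH12 := edge_count_add _ _ _ H12E; have sH13 := edge_count_add _ _ _ H13E.
have sH23 := edge_count_add _ _ _ H23E; have sb := edge_count_add _ _ _ bE.
have sc := edge_count_add _ _ _ cE; have sd := edge_count_add _ _ _ dE.
have se := edge_count_add _ _ _ eE; have sf := edge_count_add _ _ _ fE.
have sK13 := edge_count_add _ _ _ K13E; have sK23 := edge_count_add _ _ _ K23E.
have sef : edge_count (e true) + edge_count (f true) + a * #|U| = edge_count D13.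
  rewrite !edge_count_cdeg -(sumsU (fun=> a)) // -!big_split.
  by apply: eq_bigr => w _; have [_ _ _ _ [_ [_]]] := unit_sym w.
have defect_c (P : U -> U -> bool) : (forall w, cdeg P w <= a) ->
    \sum_w (a - cdeg P w) + edge_count P = a * #|U|.
  by move=> Pa; rewrite edge_count_cdeg; apply: sum_defect.
have defect_r (P : U -> U -> bool) : (forall u, rdeg P u <= a) ->
    \sum_u (a - rdeg P u) + edge_count P = a * #|U|.
  by move=> Pa; apply: sum_defect.
have diff (F G : U -> nat) : (forall u, F u <= G u) ->
    \sum_u (G u - F u) + \sum_u F u = \sum_u G u.
  by move=> FG; rewrite -big_split; apply: eq_bigr => u _; apply: subnK.
have [tc1 tc2 td1 td2] : [/\
    \sum_w (a - cdeg (c true) w) + edge_count (c true) = a * #|U|,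
    \sum_w (a - cdeg (c false) w) + edge_count (c false) = a * #|U|,
    \sum_w (a - cdeg (d true) w) + edge_count (d true) = a * #|U| &
    \sum_w (a - cdeg (d false) w) + edge_count (d false) = a * #|U|].
  by split; apply: defect_c => w; case: (unit_sym w).
have [rc1 rc2 rcb1 rcb2] : [/\
    \sum_u (a - rdeg (c true) u) + edge_count (c true) = a * #|U|,
    \sum_u (a - rdeg (c false) u) + edge_count (c false) = a * #|U|,
    \sum_u (rdeg (c false) u - rdeg (b true) u) + edge_count (b true) = edge_count (c false) &
    \sum_u (rdeg (c true) u - rdeg (b false) u) + edge_count (b false) = edge_count (c true)].
  split; [apply: defect_r => u|apply: defect_r => u|apply: diff => u|apply: diff => u];
    by case: (unit_row u) => _ [h1 h2 h3 h4 []].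
have [rd1 rd2 rdb1 rdb2] : [/\
    \sum_v (a - rdeg (d true) v) + edge_count (d true) = a * #|U|,
    \sum_v (a - rdeg (d false) v) + edge_count (d false) = a * #|U|,
    \sum_v (rdeg (d false) v - cdeg (b true) v) + edge_count (b true) = edge_count (d false) &
    \sum_v (rdeg (d true) v - cdeg (b false) v) + edge_count (b false) = edge_count (d true)].
  rewrite [edge_count (b true)]edge_count_cdeg [edge_count (b false)]edge_count_cdeg.
  split; [apply: defect_r => u|apply: defect_r => u|apply: diff => u|apply: diff => u];
    by case: (unit_col u) => _ [h1 h2 h3 h4 []].
have z0 : \sum_(u : U) 0 = 0 by apply: big1.
(* The size bound says that [D13] has at least 3as - 4a^2 pairs, s being the number of units. About
   half of the excess over as goes to each of [e true] and [f true], and halving the rest leaves at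
   least as - a^2 pairs in every colour of [c] and [d]. *)
have sizes : [/\ \sum_w (a - cdeg (c true) w) <= a * a,
    \sum_w (a - cdeg (c false) w) <= a * a,
    \sum_w (a - cdeg (d true) w) <= a * a &
    \sum_w (a - cdeg (d false) w) <= a * a].
  move: c_size d_size e_size f_size T_size; rewrite /near => *; split; lia.
case: sizes => t1 t2 t3 t4.
(* The three relations together have twice as many pairs as [D12], so the balance of their total is
   exact. This equality makes the row, column and symbol sums of the defects agree. *)
have bal : edge_count (b true) + edge_count (c true) + edge_count (d true) = edge_count D12 /\
           edge_count (b false) + edge_count (c false) + edge_count (d false) = edge_count D12.
  by move: bcd_size; rewrite /near => *; lia.
case: bal => bal1 bal2.
elim/ord3P; elim/ord3P; elim/ord3P => // _;
  rewrite /cc /r /t /rc /sel3 !ord3_eqE ?z0; split=> //; lia.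
Qed.
End SparseEmbedding.

(** * Small partial squares *)

Lemma exists_smaller_sum (T : finType) (F : T -> nat) (n : nat) :
  n <= \sum_x F x -> exists2 m : T -> nat, forall x, m x <= F x & \sum_x m x = n.
Proof.
elim: n => [|n IHn] len; first by exists (fun=> 0) => //; apply: big1.
have [m mF sum_m] := IHn (ltnW len).
have [x lt_mx] : exists x, m x < F x.
  apply/existsP; apply: contraLR len; rewrite negb_exists => /forallP ge_m.
  by rewrite -leqNgt -sum_m; apply: leq_sum => x _; rewrite leqNgt.
exists (fun y => m y + (y == x)) => [y|].
  by case: eqP => [->|_]; rewrite ?addn1 ?addn0.
rewrite big_split /= sum_m (bigD1 x) //= eqxx big1 ?addn0 ?addn1 // => y.
by move/negPf->.
Qed.

Lemma sum_color (T : finType) (k : nat) (c : T -> 'I_k) (A : pred T) i :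
  color_count c A i = \sum_y (A y && (c y == i) : nat).
Proof. by rewrite sum_bool. Qed.

(* Loops pad every degree to 3a; lam i u counts those of colour i at u. *)
Lemma equitable_degree_coloring (U : finType) (a : nat) (D : U -> U -> bool)
    (deg : U -> nat) :
  (forall u, rdeg D u = deg u) -> (forall u, cdeg D u = deg u) ->
  (forall u, deg u <= 3 * a) ->
  exists (E : 'I_3 -> U -> U -> bool) (lam : 'I_3 -> U -> nat),
    [/\ forall u v, \sum_i (E i u v : nat) = D u v,
        forall i u, rdeg (E i) u + lam i u = a,
        forall i u, cdeg (E i) u + lam i u = a &
        forall i u, 3 * lam i u <= 3 * a - deg u + 2 /\
          3 * a - deg u <= 3 * lam i u + 2].
Proof.
move=> Dr Dc deg_le; pose X : finType := (U * (U + 'I_(3 * a)))%type.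
pose S (e : X) := match e.2 with inl v => D e.1 v | inr t => t < 3 * a - deg e.1 end.
pose l1 (e : X) := (S e, e.1, if e.2 is inl _ then true else false).
pose l2 (e : X) := (S e, e.1).
pose r1 (e : X) := (S e, if e.2 is inl v then v else e.1).
have chL : chain eq_op [:: kernel l1; kernel l2].
  split; [exact: kernel_equiv | exact: sub_kernel_eq |].
  by split; [exact: kernel_equiv | exact: (kernel_factor (g := fst)) |].
have chR : chain eq_op [:: kernel r1].
  by split; [exact: kernel_equiv | exact: sub_kernel_eq |].
have [c /and4P[/forallP bl1 /forallP bl2 /forallP br1 _]] :=
  equitable_coloring (isT : 0 < 3) chL chR.
have {}bl1 x := equitable_kernel x (isT : 0 < 3) bl1.
have {}bl2 x := equitable_kernel x (isT : 0 < 3) bl2.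
have {}br1 x := equitable_kernel x (isT : 0 < 3) br1.
have sumX (G : X -> nat) :
  \sum_e G e = \sum_u (\sum_v G (u, inl v) + \sum_t G (u, inr t)).
  transitivity (\sum_u \sum_e G (u, e)); first by rewrite pair_big; apply: eq_bigr => -[].
  by apply: eq_bigr => u _; rewrite big_sumType.
pose E i u v := D u v && (c (u, inl v) == i).
pose lam i u := \sum_(t < 3 * a) ((t < 3 * a - deg u) && (c (u, inr t) == i) : nat).
have sum_lt n m : m <= n -> \sum_(t < n) (t < m : nat) = m.
  move=> le_mn; rewrite -[RHS]card_ord -sum1_card (big_ord_widen n (fun=> 1) le_mn).
  by rewrite [RHS]big_mkcond; apply: eq_bigr => t _; case: ifP.
have rowE u (Q : pred X) : \sum_e ((l2 e == (true, u)) && Q e : nat) =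
    \sum_v (D u v && Q (u, inl v) : nat) +
    \sum_(t < 3 * a) ((t < 3 * a - deg u) && Q (u, inr t) : nat).
  rewrite sumX (bigD1 u) //= [X in _ + X]big1 ?addn0 => [|u' nu]; last first.
    by rewrite !big1 // => ? _; rewrite /l2 /= xpair_eqE (negPf nu) andbF.
  by congr (_ + _); apply: eq_bigr => ? _; rewrite /l2 xpair_eqE eqxx /S /= eqb_id andbT.
have colE u (Q : pred X) : \sum_e ((r1 e == (true, u)) && Q e : nat) =
    \sum_v (D v u && Q (v, inl u) : nat) +
    \sum_(t < 3 * a) ((t < 3 * a - deg u) && Q (u, inr t) : nat).
  rewrite sumX big_split /=; congr (_ + _).
    apply: eq_bigr => u' _.
    rewrite (bigD1 u) //= [X in _ + X]big1 ?addn0 => [|v nv]; last first.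
      by rewrite /r1 /= xpair_eqE (negPf nv) andbF.
    by rewrite /r1 xpair_eqE eqxx /S /= eqb_id andbT.
  rewrite (bigD1 u) //= [X in _ + X]big1 ?addn0 => [|v nv]; last first.
    by rewrite big1 // => t _; rewrite /r1 /= xpair_eqE (negPf nv) andbF.
  by apply: eq_bigr => t _; rewrite /r1 xpair_eqE eqxx /S /= eqb_id andbT.
have loopE u (Q : pred X) : \sum_e ((l1 e == (true, u, false)) && Q e : nat) =
    \sum_(t < 3 * a) ((t < 3 * a - deg u) && Q (u, inr t) : nat).
  rewrite sumX (bigD1 u) //= [X in _ + X]big1 ?addn0 => [|u' nu]; last first.
    by rewrite !big1 // => ? _; rewrite /l1 /= !xpair_eqE (negPf nu) andbF.
  rewrite big1 ?add0n => [|v _]; last by rewrite /l1 /= !xpair_eqE andbF.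
  by apply: eq_bigr => t _; rewrite /l1 !xpair_eqE !eqxx /S /= eqb_id !andbT.
have sizeE (A : pred X) : #|[pred y | A y]| = \sum_y (A y && true : nat).
  by rewrite sum_bool; apply: eq_card => y; rewrite !inE andbT.
have loops u :
    \sum_(t < 3 * a) ((t < 3 * a - deg u) && xpredT (u, inr t : U + 'I_(3 * a)) : nat)
    = 3 * a - deg u.
  by under eq_bigr do rewrite andbT; rewrite sum_lt ?leq_subr.
exists E, lam; split.
- move=> u v; rewrite /E; case: (D u v) => /=; last by rewrite big1.
  rewrite (bigD1 (c (u, inl v))) //= eqxx big1 // => i.
  by rewrite eq_sym => /negPf->.
- move=> i u; rewrite -[RHS](equitable_exact i (bl2 (true, u))).
    by rewrite sum_color (rowE u (fun e => c e == i)).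
  rewrite sizeE (rowE u xpredT) /=.
  under eq_bigr do rewrite andbT.
  by rewrite loops -[X in X + _]/(rdeg D u) Dr subnKC.
- move=> i u; rewrite -[RHS](equitable_exact i (br1 (true, u))).
    by rewrite sum_color (colE u (fun e => c e == i)).
  rewrite sizeE (colE u xpredT) /=.
  under eq_bigr do rewrite andbT.
  by rewrite loops -[X in X + _]/(cdeg D u) Dc subnKC.
move=> i u; have := equitable_bounds i (bl1 (true, u, false)).
rewrite sum_color (loopE u (fun e => c e == i)) sizeE (loopE u xpredT).
by rewrite loops.
Qed.

(* The colour class E i serves as row-column pairs of part i-1, as row-symbol pairs
   of part i+1 and as column-symbol pairs of part i (mod 3), so the defects are the
   lam i; the amount m is moved from the even to the odd arrangements of the three
   parts to keep both within a * a. *)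
Lemma balanced_embedding (U : finType) (a : nat) (T : U -> U -> U -> bool)
    (D : U -> U -> bool) (deg : U -> nat) :
  (forall u v, \sum_w (T u v w : nat) + D u v = 1) ->
  (forall u w, \sum_v (T u v w : nat) + D u w = 1) ->
  (forall v w, \sum_u (T u v w : nat) + D v w = 1) ->
  (forall u, rdeg D u = deg u) -> (forall u, cdeg D u = deg u) ->
  (forall u, deg u <= 3 * a) -> #|U| <= a * a ->
  \sum_u (3 * a - deg u) + 2 * #|U| <= 6 * (a * a) + 2 ->
  outline_over a (fun u v w => T u v w : nat).
Proof.
move=> T12 T13 T23 Dr Dc deg_le U_le rho_le.
have [E [lam [ED Er Ec lam_le]]] := equitable_degree_coloring Dr Dc deg_le.
pose T0 := \sum_u (3 * a - deg u) %/ 3.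
have [m m_le sum_m] := exists_smaller_sum (geq_minr (a * a) T0).
have m_lam i u : m u <= lam i u.
  apply: leq_trans (m_le u) _; have [_ le_lam] := lam_le i u.
  by move: le_lam; clear; lia.
have sum1U : \sum_(u : U) 1 = #|U| by rewrite sum1_card.
have lamT0 i : \sum_u lam i u <= T0 + #|U|.
  rewrite -sum1U -big_split; apply: leq_sum => u _.
  by have [le_lam _] := lam_le i u; move: le_lam; clear => /=; lia.
have lam_rho i : 3 * \sum_u lam i u <= \sum_u (3 * a - deg u) + 2 * #|U|.
  rewrite -sum1U !big_distrr -big_split; apply: leq_sum => u _.
  by have [le_lam _] := lam_le i u; move: le_lam; clear => /=; lia.
have lam_m i : \sum_u (lam i u - m u) + \sum_u m u = \sum_u lam i u.
  by rewrite -big_split; apply: eq_bigr => u _; apply: subnK.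
(* If [m] sums to a * a, the bound 6a^2 + 2 gives at most 2a^2 for the sum of [lam i]; if it sums to
   [T0], rounding leaves at most one per unit, and there are at most a * a units. *)
have lam_m_le i : \sum_u (lam i u - m u) <= a * a.
  by move: (lam_m i) (lam_rho i) (lamT0 i); move: rho_le U_le sum_m; clear; lia.
pose E12 u v (k : 'I_3) : nat := sel3 (E o1 u v) (E o2 u v) (E o0 u v) k.
pose E13 u v (k : 'I_3) : nat := sel3 (E o2 u v) (E o0 u v) (E o1 u v) k.
pose E23 u v (k : 'I_3) : nat := E k u v.
pose r u (j k : 'I_3) : nat := sel3 (sel3 0 (lam o2 u - m u) (m u) k)
  (sel3 (m u) 0 (lam o0 u - m u) k) (sel3 (lam o1 u - m u) (m u) 0 k) j.
pose c u (i k : 'I_3) : nat := sel3 (sel3 0 (m u) (lam o0 u - m u) k)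
  (sel3 (lam o1 u - m u) 0 (m u) k) (sel3 (m u) (lam o2 u - m u) 0 k) i.
pose t u (i j : 'I_3) : nat := sel3 (sel3 0 (lam o0 u - m u) (m u) j)
  (sel3 (m u) 0 (lam o1 u - m u) j) (sel3 (lam o2 u - m u) (m u) 0 j) i.
have ED3 u v : E o0 u v + E o1 u v + E o2 u v = D u v by rewrite -ED sum_ord3.
apply: (outline_over_glue (E12 := E12) (E13 := E13) (E23 := E23) (r := r) (c := c) (t := t)).
- move=> u v; rewrite sum_ord3 /E12 /sel3 !ord3_eqE.
  by move: (T12 u v) (ED3 u v); clear; lia.
- move=> u w; rewrite sum_ord3 /E13 /sel3 !ord3_eqE.
  by move: (T13 u w) (ED3 u w); clear; lia.
- move=> v w; rewrite sum_ord3 /E23.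
  by move: (T23 v w) (ED3 v w); clear; lia.
all: try by move=> u k; move: (Er o0 u) (Er o1 u) (Er o2 u) (Ec o0 u) (Ec o1 u) (Ec o2 u)
  (m_lam o0 u) (m_lam o1 u) (m_lam o2 u); rewrite /rdeg /cdeg;
  elim/ord3P: k; rewrite sum_ord3 /E12 /E13 /E23 /r /c /t /sel3 !ord3_eqE; clear; lia.
- by move=> u; elim/ord3P; rewrite /r /c /t /sel3 !ord3_eqE.
have m_le2 : \sum_u m u <= a * a by rewrite sum_m geq_minl.
by elim/ord3P; elim/ord3P; elim/ord3P => // _; rewrite /r /c /t /sel3 !ord3_eqE.
Qed.

Lemma sum_at_most_one (I : finType) (b : bool) (P : pred I) :
  (forall i, P i -> ~~ b) -> (forall i j, P i -> P j -> i = j) ->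
  b + \sum_i (P i : nat) = (b || [exists i, P i]).
Proof.
move=> Pb P1; case: (pickP P) => [i Pi|P0].
  rewrite (negPf (Pb i Pi)) (bigD1 i) //= Pi big1 ?addn0 => [|j nj].
    by rewrite add0n; case: existsP => // -[]; exists i.
  by case: (boolP (P j)) => // Pj; rewrite (P1 _ _ Pi Pj) eqxx in nj.
rewrite big1 ?addn0 => [|i _]; last by rewrite P0.
by case: existsP => [[i]|]; rewrite ?P0 // orbF.
Qed.

Lemma sum_eq_one (I : finType) (j : I) (b : bool) :
  \sum_i (b && (i == j) : nat) = b.
Proof.
rewrite (bigD1 j) //= eqxx andbT big1 ?addn0 // => i /negPf->.
by rewrite andbF.
Qed.

(** * Circulant layers *)

(* T0 fills the subsquares on the blocks B, of size h; layer i consists of the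
   triples (u, u + dd i, u + ee i) with W i u. *)
Section Circulant.
Variables (V : finZmodType) (a F : nat).
Variables (T0 : V -> V -> V -> bool) (B : V -> V -> bool) (h : V -> nat).
Variables (dd ee cc : 'I_F -> V) (far : pred V) (W : 'I_F -> V -> bool).
Hypothesis T0_12 : forall u v, \sum_w (T0 u v w : nat) = B u v.
Hypothesis T0_13 : forall u w, \sum_v (T0 u v w : nat) = B u w.
Hypothesis T0_23 : forall v w, \sum_u (T0 u v w : nat) = B v w.
Hypothesis B_r : forall u, \sum_v (B u v : nat) = h u.
Hypothesis B_c : forall v, \sum_u (B u v : nat) = h v.
Hypothesis B_far : forall u v, B u v -> ~~ far (v - u)%R.
Hypothesis dd_inj : injective dd.
Hypothesis ee_inj : injective ee.
Hypothesis cc_inj : injective cc.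
Hypothesis dd_cc : forall i, (dd i + cc i)%R = ee i.
Hypothesis far_dd : forall i, far (dd i).
Hypothesis far_ee : forall i, far (ee i).
Hypothesis far_cc : forall i, far (cc i).
Hypothesis far_card : F + a <= #|far|.
Hypothesis W_r : forall u, #|V| <= h u + \sum_i (W i u : nat) + 3 * a.
Hypothesis W_c : forall v, #|V| <= h v + \sum_i (W i (v - dd i)%R : nat) + 3 * a.
Hypothesis W_s : forall w, #|V| <= h w + \sum_i (W i (w - ee i)%R : nat) + 3 * a.
Hypothesis W_size : \sum_u h u + \sum_i \sum_u (W i u : nat) + 3 * a * #|V| <=
  4 * (a * a) + #|V| * #|V|.

(** The layers use at most F of the far differences, so a others remain; joining the pairs with
    these differences gives a relation of degree a that avoids both layers and blocks. *)
Lemma circulant_relation (x : 'I_F -> V)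
    (R := fun C : {set V} => fun u v : V => (v - u)%R \in C) :
  exists C : {set V}, [/\ forall u, rdeg (R C) u = a, forall v, cdeg (R C) v = a,
    forall d, d \in C -> far d & forall i, x i \notin C].
Proof.
pose Z := [set d | far d] :\: [set x i | i : 'I_F].
have leZ : a <= #|Z|.
  have le_img : #|[set x i | i : 'I_F]| <= F.
    by apply: leq_trans (leq_imset_card _ _) _; rewrite card_ord.
  rewrite cardsD; have := subset_leq_card (subsetIr [set d | far d] [set x i | i : 'I_F]).
  have -> : #|[set d | far d]| = #|far| by apply: eq_card => d; rewrite inE.
  by move: far_card le_img; lia.
have [C CZ cardC] : exists2 C : {set V}, C \subset Z & #|C| = a.
  exists [set d in take a (enum Z)].
    by apply/subsetP => d; rewrite inE => /mem_take; rewrite mem_enum.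
  by rewrite cardsE (card_uniqP (take_uniq _ (enum_uniq _))) size_takel // -cardE.
exists C; split.
- move=> u; rewrite /rdeg sum_bool -cardC -(card_imset _ (@addIr _ u)).
  apply: eq_card => v; rewrite !inE /R; apply/idP/imsetP => [|[d dC ->]].
    by exists (v - u)%R; rewrite ?subrK.
  by rewrite addrK.
- move=> v; rewrite /cdeg sum_bool -cardC -(card_imset _ (@subrI _ v)).
  apply: eq_card => u; rewrite !inE /R; apply/idP/imsetP => [|[d dC ->]].
    by exists (v - u)%R; rewrite // opprB addrC subrK.
  by rewrite opprB addrC subrK.
- by move=> d /(subsetP CZ); rewrite !inE => /andP[].
move=> i; apply/negP => /(subsetP CZ); rewrite !inE => /andP[/negP[]].
by apply: imset_f.
Qed.

(** The pairs of layer i have differences [dd i], [ee i] and [cc i]. Each family is injective and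
    far, so no pair is covered by two layers or by a layer and a block. *)
Lemma circulant_embedding : exists T : V -> V -> V -> bool,
  outline_over a (fun u v w => T u v w : nat) /\
  forall u v w, B u v -> T u v w = T0 u v w.
Proof.
pose L u v w i := [&& W i u, v == (u + dd i)%R & w == (u + ee i)%R].
pose T u v w := T0 u v w || [exists i, L u v w i].
have T0B u v w : T0 u v w -> [/\ B u v, B u w & B v w].
  move=> Tuvw; split; rewrite -[B _ _]lt0b.
  - by rewrite -T0_12 (bigD1 w) //= Tuvw.
  - by rewrite -T0_13 (bigD1 v) //= Tuvw.
  by rewrite -T0_23 (bigD1 u) //= Tuvw.
have B_dd i u : ~~ B u (u + dd i)%R.
  by apply: contraL (far_dd i) => /B_far; rewrite addrAC subrr add0r.
have B_ee i u : ~~ B u (u + ee i)%R.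
  by apply: contraL (far_ee i) => /B_far; rewrite addrAC subrr add0r.
have B_cc i u : ~~ B (u + dd i)%R (u + ee i)%R.
  apply: contraL (far_cc i) => /B_far.
  by rewrite -dd_cc addrA [(_ - _)%R]addrAC subrr add0r.
have TE u v w : (T u v w : nat) = T0 u v w + \sum_i (L u v w i : nat).
  rewrite sum_at_most_one // => [i /and3P[_ /eqP-> _]|i j].
    by apply: contra (B_dd i u) => /T0B[].
  by move=> /and3P[_ /eqP-> _] /and3P[_ /eqP/addrI/dd_inj].
have S12 u v : \sum_w (T u v w : nat) =
    B u v + \sum_i (W i u && (v == u + dd i)%R : nat).
  under eq_bigr do rewrite TE; rewrite big_split /= T0_12 exchange_big /=.
  congr (_ + _); apply: eq_bigr => i _; rewrite -[RHS](sum_eq_one (u + ee i)%R).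
  by apply: eq_bigr => w _; rewrite /L andbA.
have S13 u w : \sum_v (T u v w : nat) =
    B u w + \sum_i (W i u && (w == u + ee i)%R : nat).
  under eq_bigr do rewrite TE; rewrite big_split /= T0_13 exchange_big /=.
  congr (_ + _); apply: eq_bigr => i _; rewrite -[RHS](sum_eq_one (u + dd i)%R).
  by apply: eq_bigr => v _; rewrite /L -andbA; congr ((_ && _) : nat); apply: andbC.
have S23 v w : \sum_u (T u v w : nat) =
    B v w + \sum_i (W i (v - dd i)%R && (w == v + cc i)%R : nat).
  under eq_bigr do rewrite TE; rewrite big_split /= T0_23 exchange_big /=.
  congr (_ + _); apply: eq_bigr => i _; rewrite -[RHS](sum_eq_one (v - dd i)%R).
  apply: eq_bigr => u _; rewrite /L -dd_cc addrA.
  case: (eqVneq u (v - dd i)%R) => [->|nu]; first by rewrite subrK eqxx !andbT.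
  rewrite andbF; case: eqP => [e|_]; first by rewrite e addrK eqxx in nu.
  by rewrite andbF.
have T12 u v : \sum_w (T u v w : nat) = B u v || [exists i, W i u && (v == u + dd i)%R].
  rewrite S12 sum_at_most_one // => [i /andP[_ /eqP->] //|i j].
  by move=> /andP[_ /eqP->] /andP[_ /eqP/addrI/dd_inj].
have T13 u w : \sum_v (T u v w : nat) = B u w || [exists i, W i u && (w == u + ee i)%R].
  rewrite S13 sum_at_most_one // => [i /andP[_ /eqP->] //|i j].
  by move=> /andP[_ /eqP->] /andP[_ /eqP/addrI/ee_inj].
have T23 v w : \sum_u (T u v w : nat) =
    B v w || [exists i, W i (v - dd i)%R && (w == v + cc i)%R].
  rewrite S23 sum_at_most_one // => [i /andP[_ /eqP->]|i j].
    by have := B_cc i (v - dd i)%R; rewrite -dd_cc addrA subrK.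
  by move=> /andP[_ /eqP->] /andP[_ /eqP/addrI/cc_inj].
have N1 u : \sum_v \sum_w (T u v w : nat) = h u + \sum_i (W i u : nat).
  under eq_bigr do rewrite S12; rewrite big_split /= B_r exchange_big /=.
  by congr (_ + _); apply: eq_bigr => i _; apply: sum_eq_one.
have shift (x : V) (P : V -> bool) v :
    \sum_u (P u && (v == u + x)%R : nat) = P (v - x)%R.
  rewrite -[RHS](sum_eq_one (v - x)%R); apply: eq_bigr => u _.
  case: (eqVneq u (v - x)%R) => [->|nu]; first by rewrite subrK eqxx.
  case: eqP => [e|_]; first by rewrite e addrK eqxx in nu.
  by rewrite !andbF.
have N2 v : \sum_u \sum_w (T u v w : nat) = h v + \sum_i (W i (v - dd i)%R : nat).
  under eq_bigr do rewrite S12; rewrite big_split /= B_c exchange_big /=.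
  by congr (_ + _); apply: eq_bigr => i _; apply: shift.
have N3 w : \sum_u \sum_v (T u v w : nat) = h w + \sum_i (W i (w - ee i)%R : nat).
  under eq_bigr do rewrite S13; rewrite big_split /= B_c exchange_big /=.
  by congr (_ + _); apply: eq_bigr => i _; apply: shift.
have [C12 [r12 c12 f12 n12]] := circulant_relation dd.
have [C13 [r13 c13 f13 n13]] := circulant_relation ee.
have [C23 [r23 c23 f23 n23]] := circulant_relation cc.
exists T; split; last first.
  move=> u v w Buv; rewrite /T orbC; case: existsP => // -[i /and3P[_ /eqP ev _]].
  by have := B_dd i u; rewrite -ev Buv.
have no_rel (C : {set V}) (x : 'I_F -> V) (P : 'I_F -> V -> bool) u v :
    (forall d, d \in C -> far d) -> (forall i, x i \notin C) -> (v - u)%R \in C ->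
    (B u v || [exists i, P i u && (v == u + x i)%R]) = false.
  move=> Cfar xC vuC; apply/norP; split.
    by apply: contraL (Cfar _ vuC); apply: B_far.
  apply/existsP => -[i /andP[_ /eqP e]].
  by have := xC i; rewrite -(addKr u (x i)) addrC -e vuC.
apply: (sparse_embedding _ _ _ _ _ _ _ r12 c12 r13 c13 r23 c23).
- by move=> u v; rewrite T12 leq_b1.
- by move=> u w; rewrite T13 leq_b1.
- by move=> v w; rewrite T23 leq_b1.
- by move=> u; rewrite N1.
- by move=> v; rewrite N2.
- by move=> w; rewrite N3.
- under eq_bigr do rewrite N1; rewrite big_split /= [X in _ + X + _]exchange_big.
  exact: W_size.
- by move=> u v uvC; rewrite T12 (no_rel C12 dd W).
- by move=> u w uwC; rewrite T13 (no_rel C13 ee W).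
by move=> v w vwC; rewrite T23 (no_rel C23 cc (fun i v => W i (v - dd i)%R)).
Qed.
End Circulant.

(** * Subsquares on consecutive units *)

Section Blocks.
Variables (hs : seq nat) (n : nat).
Hypothesis n_sum : n = sumn hs.

Definition block (x : nat) := reshape_index hs x.
Definition offset (x : nat) := reshape_offset hs x.
Definition block_size (x : nat) := nth 0 hs (block x).

Definition block_latin (u v w : 'I_n) : bool :=
  [&& block u == block v, block v == block w &
      offset w == (offset u + offset v) %% block_size u].

Lemma offset_lt (x : 'I_n) : offset x < block_size x.
Proof. by apply: reshape_offsetP; rewrite -n_sum. Qed.

Lemma sum_cell r t : t < nth 0 hs r ->
  \sum_(x < n) ((block x == r) && (offset x == t) : nat) = 1.
Proof.
move=> lt_t; have lt_n : flatten_index hs r t < n by rewrite n_sum flatten_indexP.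
rewrite -[RHS](sum_eq_one (Ordinal lt_n) true); apply: eq_bigr => x _.
congr nat_of_bool; apply/andP/eqP => /= [[/eqP e1 /eqP e2]|->].
  by apply: val_inj; rewrite /= -e1 -e2 reshape_indexK.
by rewrite /block /offset flatten_indexKl ?flatten_indexKr.
Qed.

Lemma card_block r : \sum_(x < n) (block x == r : nat) = nth 0 hs r.
Proof.
rewrite -[RHS]card_ord -sum1_card -(eq_bigr _ (fun t _ => sum_cell (ltn_ord t))).
rewrite exchange_big; apply: eq_bigr => x _ /=.
case: eqP => [e|_]; last by rewrite big1.
have lt_x : offset x < nth 0 hs r by rewrite -e; apply: offset_lt.
rewrite -[LHS](sum_eq_one (Ordinal lt_x) true); apply: eq_bigr => t _.
by rewrite -val_eqE /= eq_sym.
Qed.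

Lemma block_latin12 u v : \sum_w (block_latin u v w : nat) = (block u == block v).
Proof.
rewrite /block_latin; case: eqP => [e|_] /=; last by rewrite big1.
have lt_m : (offset u + offset v) %% block_size u < nth 0 hs (block v).
  by rewrite -e ltn_mod; apply: leq_ltn_trans (offset_lt u).
by rewrite -[RHS](sum_cell lt_m); apply: eq_bigr => w _; rewrite [block w == _]eq_sym.
Qed.

Lemma modn_sub_eq m x y z : x < m -> y < m -> z < m ->
  (z == (x + y) %% m) = (y == (z + (m - x)) %% m).
Proof.
move=> xm ym zm.
have [lt|le] := ltnP (x + y) m.
  rewrite [(x + y) %% m]modn_small //.
  have [lt'|le'] := ltnP (z + (m - x)) m; last first.
    have -> : z + (m - x) = m + (z - x) by lia.
    by rewrite modnDl modn_small; lia.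
  by rewrite modn_small //; lia.
have -> : x + y = m + (x + y - m) by lia.
rewrite modnDl [(x + y - m) %% m]modn_small; last by lia.
have [lt'|le'] := ltnP (z + (m - x)) m; first by rewrite modn_small //; lia.
have -> : z + (m - x) = m + (z - x) by lia.
by rewrite modnDl modn_small; lia.
Qed.

Lemma block_latin13 u w : \sum_v (block_latin u v w : nat) = (block u == block w).
Proof.
rewrite /block_latin; case: (eqVneq (block u) (block w)) => [e|ne] /=; last first.
  by rewrite big1 // => v _; case: eqP => //= <-; rewrite (negPf ne).
have lt_m : (offset w + (block_size u - offset u)) %% block_size u < nth 0 hs (block w).
  by rewrite -e ltn_mod; apply: leq_ltn_trans (offset_lt u).
rewrite -[RHS](sum_cell lt_m); apply: eq_bigr => v _; rewrite e [block w == _]eq_sym.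
case: (eqVneq (block v) (block w)) => //= e'; congr nat_of_bool.
apply: modn_sub_eq; rewrite ?offset_lt //.
  by rewrite /block_size e -e'; apply: offset_lt.
by rewrite /block_size e; apply: offset_lt.
Qed.

Lemma block_latin23 v w : \sum_u (block_latin u v w : nat) = (block v == block w).
Proof.
rewrite -block_latin13; apply: eq_bigr => u _; rewrite /block_latin.
by rewrite [RHS]/= addnC /block_size; case: eqVneq => // ->.
Qed.

Lemma block_near (x y : 'I_n) : block x = block y -> y < x + block_size x.
Proof.
move=> e; have := reshape_indexK hs x; have := reshape_indexK hs y.
have := offset_lt y; rewrite /block_size -e -/(block x) -/(block y) -/(offset x).
rewrite -/(offset y) -e /flatten_index; lia.
Qed.

Hypothesis hs_sorted : sorted geq hs.

Lemma block_size_mono x y : x <= y -> y < n -> block_size y <= block_size x.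
Proof.
rewrite (reshape_leq hs) => le_xy lt_y.
have lt_by : block y < size hs by apply: reshape_indexP; rewrite -n_sum.
have le_b : block x <= block y.
  by case/orP: le_xy => [/ltnW //|/andP[/eqP e _]]; rewrite /block e.
have geq_trans : transitive geq by move=> b a c /= ab bc; apply: leq_trans bc ab.
by apply: (sorted_leq_nth geq_trans leqnn); rewrite ?inE // (leq_ltn_trans le_b).
Qed.
End Blocks.

(* The row-symbol shifts are even in the first family of layers and odd in the
   second; the other two shifts are below s / 2 in the first family and above it in
   the second. *)
Section LayerShifts.
Variables (s a b : nat).
(** Counts the i with 2 * (b + i) <= s - b, for which the doubled shift still avoids the blocks. *)
Definition even_layers := (s - b)./2 + 1 - b.
Definition shift12 i :=
  if i < even_layers then b + i else s - (b + 1 + (i - even_layers)).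
(** [s + ~~ odd s] is the odd one of s and s + 1, which makes the shifts of the second family
    odd. *)
Definition shift13 i :=
  if i < even_layers then 2 * (b + i)
  else s + ~~ odd s - 2 * (b + 1 + (i - even_layers)).
Definition shift23 i :=
  if i < even_layers then b + i else s + ~~ odd s - (b + 1 + (i - even_layers)).

Hypothesis b_gt0 : 0 < b.
Hypothesis b_le : b <= a.

(** The two families have room for at least s - 3b far layers, and b <= a. *)
Lemma shift_far i : i < s - 3 * a - 1 ->
  [/\ b <= shift12 i, shift12 i + b <= s, b <= shift13 i, shift13 i + b <= s &
      b <= shift23 i /\ shift23 i + b <= s].
Proof.
rewrite /shift12 /shift13 /shift23 /even_layers => lt_i.
by case: ltnP => lt_ic; split; lia.
Qed.

Lemma shift_add i : i < s - 3 * a - 1 ->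
  shift12 i + shift23 i = shift13 i \/ shift12 i + shift23 i = s + shift13 i.
Proof.
rewrite /shift12 /shift13 /shift23 /even_layers => lt_i.
by case: ltnP => lt_ic; lia.
Qed.

Lemma shift_inj i j : i < s - 3 * a - 1 -> j < s - 3 * a - 1 ->
  [/\ shift12 i = shift12 j -> i = j, shift13 i = shift13 j -> i = j &
      shift23 i = shift23 j -> i = j].
Proof.
rewrite /shift12 /shift13 /shift23 /even_layers => lt_i lt_j.
by case: ltnP => lt_ic; case: ltnP => lt_jc; split; lia.
Qed.
End LayerShifts.

(** * Size of the layers and the two embeddings *)

Lemma sum_ord_range F p q : \sum_(i < F) (p <= i < q : nat) = minn q F - p.
Proof.
elim: F => [|F IHF]; first by rewrite big_ord0; lia.
by rewrite big_ord_recr /= IHF; lia.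
Qed.

Lemma sum_layers F m b n : \sum_(i < F) (if i < m then 2 * (b + i) else n) =
  minn F m * (2 * b + minn F m - 1) + (F - m) * n.
Proof.
elim: F => [|F IHF]; first by rewrite big_ord0 min0n.
rewrite big_ord_recr /= IHF; case: (ltnP F m) => lt_F.
  have -> : minn F.+1 m = F.+1 by lia.
  have [-> ->] : F - m = 0 /\ F.+1 - m = 0 by lia.
  nia.
have -> : minn F.+1 m = m by lia.
by rewrite subSn // mulSn; lia.
Qed.

(** Without layers, 4as <= (2a)^2 + s^2 is enough. With F > 0 the claim reads s(b - 1 - m) + m(2b +
    m - 1) <= 4a^2. For s <= 4a it holds with m = 0; beyond that, thinning helps, up to m = b - 1,
    after which a thinned layer would be full anyway, or until the even layers run out, when s <= 3b
    + 2c - 1. *)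
Lemma layer_budget s a b (F := s - 3 * a - 1)
    (m := if s <= 4 * a then 0 else minn (even_layers s b) b.-1) :
  0 < b -> b <= a ->
  m <= F /\ s * b + m * (2 * b + m - 1) + (F - m) * s + 3 * a * s <=
    4 * (a * a) + s * s.
Proof.
move=> b0 ba; rewrite /m /F /even_layers {m F}; case: (leqP s (4 * a)) => [le_s|lt_s].
  split=> //; rewrite mul0n addn0 subn0.
  case: (leqP s (3 * a)) => [le3|lt3].
    have -> : s - 3 * a - 1 = 0 by lia.
    have [+ _] := nat_Cauchy (2 * a) s; rewrite -!mulnn => sq.
    have : s * b <= s * a by rewrite leq_mul2l ba orbT.
    move=> sb; clear -sq sb; lia.
  have [r er] : exists r, s = 3 * a + 1 + r by exists (s - 3 * a - 1); lia.
  rewrite er in le_s *; have -> : 3 * a + 1 + r - 3 * a - 1 = r by lia.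
  nia.
set c := (s - b)./2 + 1 - b.
have [r er] : exists r, s = 4 * a + 1 + r by exists (s - 4 * a - 1); lia.
have [le_c|lt_c] := leqP b.-1 c.
  have -> : b.-1 = b - 1 by lia.
  split; first lia.
  have -> : s - 3 * a - 1 - (b - 1) = a + r + 1 - b by lia.
  have [b' eb] : exists b', b = b'.+1 by exists b.-1; lia.
  have [d ed] : exists d, a = b' + 1 + d by exists (a - b); lia.
  have -> : a + r + 1 - b = r + d + 1 by lia.
  rewrite er eb ed subn1 /=; clear; nia.
have le_s : s <= 3 * b + 2 * c - 1 by rewrite /c; lia.
split; first lia.
have c0 : 0 < c by lia.
have -> : s - 3 * a - 1 - c = s - (3 * a + 1 + c) by lia.
have [f ef] : exists f, s = 3 * a + 1 + c + f by exists (s - 3 * a - 1 - c); lia.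
have [g eg] : exists g, b = c + 2 + g by exists (b - c - 2); lia.
have -> : s - (3 * a + 1 + c) = f by lia.
clearbody c; clear er lt_s r.
have h1 : s * (1 + g) <= (3 * b + 2 * c - 1) * (1 + g) by rewrite leq_mul2r le_s orbT.
have h2 : b * b <= a * a by rewrite leq_mul.
have h3 : s * s = (3 * a + 1 + c + f) * s by rewrite -ef.
have h4 : 3 * b + 2 * c - 1 = 5 * c + 5 + 3 * g by lia.
rewrite h3; rewrite h4 in h1; rewrite eg in h2 *.
have -> : 2 * (c + 2 + g) + c - 1 = 3 * c + 3 + 2 * g by lia.
by clear -h1 h2; nia.
Qed.

(* The first m layers are thinned to the units they have to cover, namely those in
   blocks of size at most i + 1; the set is chosen so that such a unit is covered
   as row, column and symbol, and the total size stays within layer_budget. *)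
Lemma large_embedding (hs : seq nat) (n a b : nat) :
  n.+1 = sumn hs -> sorted geq hs -> (forall x, block_size hs x <= b) ->
  0 < b -> b <= a -> a + 2 * b <= n.+1 + 1 ->
  exists T : 'I_n.+1 -> 'I_n.+1 -> 'I_n.+1 -> bool,
    outline_over a (fun u v w => T u v w : nat) /\
    forall u v w : 'I_n.+1, block hs u == block hs v -> T u v w = block_latin hs u v w.
Proof.
move=> n_sum hs_sorted size_b b0 ba le_n.
pose F := n.+1 - 3 * a - 1.
pose m := if n.+1 <= 4 * a then 0 else minn (even_layers n.+1 b) b.-1.
have [mF budget] := layer_budget n.+1 b0 ba.
rewrite -/F -/m in mF budget.
have m_even : m <= even_layers n.+1 b by rewrite /m; case: ifP; lia.
have m_b : m <= b.-1 by rewrite /m; case: ifP; lia.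
have bs0 (x : 'I_n.+1) : 0 < block_size hs x.
  exact: leq_ltn_trans (leq0n _) (offset_lt n_sum x).
pose far (x : 'I_n.+1) := (b <= x) && (x + b <= n.+1).
have farP (i : 'I_F) := shift_far b0 ba (ltn_ord i).
have val_inord x : x + b <= n.+1 -> (inord x : 'I_n.+1) = x :> nat.
  by move=> le_x; rewrite inordK //; lia.
pose dd (i : 'I_F) : 'I_n.+1 := inord (shift12 n.+1 b i).
pose ee (i : 'I_F) : 'I_n.+1 := inord (shift13 n.+1 b i).
pose cc (i : 'I_F) : 'I_n.+1 := inord (shift23 n.+1 b i).
have ddE i : dd i = shift12 n.+1 b i :> nat by rewrite val_inord //; have [] := farP i.
have eeE i : ee i = shift13 n.+1 b i :> nat by rewrite val_inord //; have [] := farP i.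
have ccE i : cc i = shift23 n.+1 b i :> nat.
  by rewrite val_inord //; have [_ _ _ _ []] := farP i.
have valD (x y : 'I_n.+1) : (x + y)%R = (x + y) %% n.+1 :> nat by [].
(* Block sizes decrease along the units, so in a triple that does not wrap around, the symbol u +
   2(b + i) lies in the smallest block of the three and is tested for all of them. The 2(b + i)
   triples whose symbol wraps are all kept. *)
pose W (i : 'I_F) (u : 'I_n.+1) := (i < m) ==>
  ((n.+1 <= u + 2 * (b + i)) || (block_size hs (u + 2 * (b + i)) < i + 2)).
have mono x y : x <= y -> y < n.+1 -> block_size hs y <= block_size hs x.
  exact: (block_size_mono n_sum hs_sorted).
have m_shift (i : 'I_F) : i < m ->
    shift12 n.+1 b i = b + i /\ shift13 n.+1 b i = 2 * (b + i).
  by move=> lt_i; rewrite /shift12 /shift13 (leq_trans lt_i m_even).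
(* A unit in a block of size h misses only layers i < h - 1, so its block and its layers cover at
   least h + F - (h - 1) = F + 1 pairs. *)
have cover (x : 'I_n.+1) (W' : 'I_F -> bool) :
    (forall i : 'I_F, (i < m -> block_size hs x < i + 2) -> W' i) ->
    #|'I_n.+1| <= block_size hs x + \sum_i (W' i : nat) + 3 * a.
  move=> W'P; have : \sum_(i < F) 1 <=
      \sum_i (W' i : nat) + \sum_(i < F) (0 <= i < block_size hs x - 1 : nat).
    rewrite -big_split; apply: leq_sum => i _ /=.
    case: (boolP (W' i)) => // nW; rewrite add0n lt0b; apply: contraR nW => nlt.
    by apply: W'P => _; lia.
  rewrite sum_ord_range sum1_card !card_ord.
  by have := bs0 x; rewrite /F; move: (\sum_i _); clear; lia.
have W_sh (i : 'I_F) (u x : 'I_n.+1) : (i < m -> u + 2 * (b + i) < n.+1 ->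
     block_size hs (u + 2 * (b + i)) <= block_size hs x) ->
   (i < m -> block_size hs x < i + 2) -> W i u.
  move=> le_bs lt_bs; apply/implyP => lt_i; case: (leqP n.+1) => //= lt_n.
  exact: leq_ltn_trans (le_bs lt_i lt_n) (lt_bs lt_i).
apply: (@circulant_embedding _ a F (@block_latin hs _)
  (fun u v => block hs u == block hs v) (fun u => block_size hs u) dd ee cc far W).
- exact: block_latin12.
- exact: block_latin13.
- exact: block_latin23.
- by move=> u; rewrite -[RHS](card_block n_sum); apply: eq_bigr => v _; rewrite eq_sym.
- by move=> v; apply: (card_block n_sum).
- move=> u v /eqP e; have := block_near n_sum e; have := block_near n_sum (esym e).
  have := size_b u; have := size_b v; rewrite /far valD.
  have -> : (- u)%R = (n.+1 - u) %% n.+1 :> nat by [].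
  have lt_u : u < n.+1 := ltn_ord u; have lt_v : v < n.+1 := ltn_ord v.
  rewrite modnDmr; case: (leqP u v) => [le_uv|lt_vu].
    have -> : v + (n.+1 - u) = n.+1 + (v - u) by lia.
    by rewrite modnDl modn_small; lia.
  by rewrite modn_small; lia.
- move=> i j /(congr1 (@nat_of_ord n.+1)); rewrite !ddE => e; apply: val_inj.
  by have [inj _ _] := shift_inj b0 ba (ltn_ord i) (ltn_ord j); apply: inj.
- move=> i j /(congr1 (@nat_of_ord n.+1)); rewrite !eeE => e; apply: val_inj.
  by have [_ inj _] := shift_inj b0 ba (ltn_ord i) (ltn_ord j); apply: inj.
- move=> i j /(congr1 (@nat_of_ord n.+1)); rewrite !ccE => e; apply: val_inj.
  by have [_ _ inj] := shift_inj b0 ba (ltn_ord i) (ltn_ord j); apply: inj.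
- move=> i; apply: (@ord_inj n.+1); rewrite valD ddE ccE eeE.
  have [_ _ h1 h2 _] := farP i.
  by case: (shift_add b0 ba (ltn_ord i)) => ->; rewrite ?modnDl modn_small //; lia.
- by move=> i; rewrite /far ddE; have [-> ->] := farP i.
- by move=> i; rewrite /far eeE; have [_ _ -> ->] := farP i.
- by move=> i; rewrite /far ccE; have [_ _ _ _ [-> ->]] := farP i.
- have -> : #|far| = \sum_(x < n.+1) (b <= x < n.+1 + 1 - b : nat).
    rewrite sum_bool; apply: eq_card => x; rewrite !inE /far.
    by congr (_ && _); lia.
  by rewrite sum_ord_range /F; lia.
- move=> u; apply: cover => i; apply: W_sh => lt_i lt_n.
  by apply: mono => //; apply: leq_addr.
- move=> v; apply: cover => i; apply: W_sh => lt_i lt_n.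
  have [e1 _] := m_shift i lt_i.
  have : (v - dd i + dd i)%R = v by rewrite subrK.
  move/(congr1 (@nat_of_ord n.+1)); rewrite valD ddE e1 modn_small => [e2|]; last first.
    by apply: leq_ltn_trans lt_n; rewrite leq_add2l leq_pmull.
  by rewrite -[X in _ <= block_size hs X]e2; apply: mono lt_n; rewrite leq_add2l leq_pmull.
- move=> w; apply: cover => i; apply: W_sh => lt_i lt_n.
  have [_ e1] := m_shift i lt_i.
  have : (w - ee i + ee i)%R = w by rewrite subrK.
  by move/(congr1 (@nat_of_ord n.+1)); rewrite valD eeE e1 modn_small // => ->.
have W_le (i : 'I_F) : \sum_u (W i u : nat) <= (if i < m then 2 * (b + i) else n.+1) +
    \sum_(x < n.+1) ((i < m) && (block_size hs x < i + 2) : nat).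
  case: (ltnP i m) => lt_i /=; last first.
    rewrite -[X in X + _]card_ord -sum1_card; apply: leq_trans (leq_addr _ _).
    by apply: leq_sum => u _; apply: leq_b1.
  have [_ e1] := m_shift i lt_i.
  have -> : 2 * (b + i) = \sum_(x < n.+1) (0 <= x < 2 * (b + i) : nat).
    by rewrite sum_ord_range; have [_ _ _] := farP i; rewrite e1; lia.
  rewrite -big_split /= [X in _ <= X](reindex_inj (addIr (ee i))) /=.
  apply: leq_sum => u _; rewrite eeE e1 /W lt_i /=.
  case: (leqP n.+1) => lt_n /=; last by rewrite modn_small // leq_addl.
  have -> : u + 2 * (b + i) = n.+1 + (u + 2 * (b + i) - n.+1) by lia.
  have lt_u : u < n.+1 := ltn_ord u; have [_ _ _] := farP i; rewrite e1 => le_e _.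
  by rewrite modnDl modn_small; lia.
(* A unit in a block of size h is charged only by layers h - 1 <= i < m, at most b - h of them since
   m < b; block and charges give at most b per unit. *)
have sum_b : \sum_(x < n.+1) (block_size hs x +
    \sum_(i < F) ((i < m) && (block_size hs x < i + 2) : nat)) <= n.+1 * b.
  rewrite -[X in X * b]card_ord -sum_nat_const; apply: leq_sum => x _.
  have -> : \sum_(i < F) ((i < m) && (block_size hs x < i + 2) : nat) =
            \sum_(i < F) (block_size hs x - 1 <= i < m : nat).
    by apply: eq_bigr => i _; congr nat_of_bool; have := bs0 x; lia.
  by rewrite sum_ord_range; have := bs0 x; have := size_b x; lia.
have := sum_layers F m b n.+1; rewrite (minn_idPr mF) => e_layers.
rewrite card_ord; apply: leq_trans budget; rewrite leq_add2r.
have W_sum : \sum_i \sum_u (W i u : nat) <=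
    \sum_(i < F) ((if i < m then 2 * (b + i) else n.+1) +
      \sum_(x < n.+1) ((i < m) && (block_size hs x < i + 2) : nat)).
  by apply: leq_sum => i _; apply: W_le.
rewrite big_split /= e_layers in W_sum.
rewrite big_split exchange_big /= in sum_b.
apply: leq_trans (leq_add (leqnn _) W_sum) _.
by rewrite addnCA -[X in _ <= X]addnA [X in _ <= X]addnC leq_add2l.
Qed.

(** Here n <= 3a - 2 keeps all degrees below 3a, and the total defect plus 2n is at most n(4a + 2 -
    n) <= (2a + 1)^2, which stays below 6a^2 + 2 once a > 1. *)
Lemma small_embedding (hs : seq nat) (n a b : nat) :
  n = sumn hs -> (forall x, block_size hs x <= b) ->
  0 < a -> b <= a -> n = 0 \/ n + 1 < a + 2 * b ->
  outline_over a (fun u v w : 'I_n => block_latin hs u v w : nat).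
Proof.
move=> n_sum size_b a0 ba n_small.
have bs (x : 'I_n) : 0 < block_size hs x <= n.
  rewrite (leq_ltn_trans (leq0n _) (offset_lt n_sum x)) /=.
  rewrite -[X in X <= _](card_block n_sum) -[X in _ <= X]card_ord -sum1_card.
  by apply: leq_sum => y _; apply: leq_b1.
have n_le (x : 'I_n) : n + 2 <= 3 * a by case: n_small => e; have := ltn_ord x; lia.
have degE (x : 'I_n) : \sum_(y < n) (block hs x != block hs y : nat) = n - block_size hs x.
  apply/eqP; rewrite -(eqn_add2l (block_size hs x)) subnKC; last by case/andP: (bs x).
  rewrite -[X in X + _](card_block n_sum) -big_split -[X in _ == X]card_ord -sum1_card.
  by apply/eqP/eq_bigr => y _; rewrite [block hs y == _]eq_sym; case: eqP.
apply: (balanced_embedding (T := @block_latin hs n) (D := fun u v => block hs u != block hs v)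
          (deg := fun u => n - block_size hs u)).
- by move=> u v; rewrite block_latin12 //; case: eqP.
- by move=> u v; rewrite block_latin13 //; case: eqP.
- by move=> u v; rewrite block_latin23 //; case: eqP.
- exact: degE.
- by move=> u; rewrite -degE; apply: eq_bigr => v _; rewrite eq_sym.
- by move=> u; have := n_le u; lia.
- rewrite card_ord; case: n_small => [->//|lt_n].
  (* The bound 3a - 2 <= a * a is (a - 1)(a - 2) >= 0. *)
  have [d ed] : exists d, a = d.+1 by exists a.-1; rewrite prednK.
  have le_dd : d <= d * d by case: (d) => // d'; rewrite leq_pmulr.
  by rewrite ed in ba lt_n *; move: ba lt_n le_dd; clear; lia.
have le_sum : \sum_(u < n) (3 * a - (n - block_size hs u)) <= n * (3 * a + b - n).
  have <- : \sum_(u < n) (3 * a + b - n) = n * (3 * a + b - n).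
    by rewrite sum_nat_const card_ord.
  apply: leq_sum => u _.
  by have := size_b u; have := bs u; have := n_le u; lia.
rewrite card_ord; apply: leq_trans (leq_add le_sum (leqnn _)) _.
case: n_small => [->//|lt_n].
have le_q : n * (3 * a + b - n) + 2 * n <= n * (4 * a + 2 - n).
  by rewrite [2 * n]mulnC -mulnDr leq_mul2l; lia.
apply: leq_trans le_q _.
have [e1|lt_a] : a = 1 \/ 1 < a by lia.
  have [-> | ->] : n = 0 \/ n = 1 by lia.
    by rewrite e1.
  by rewrite e1.
have [+ _] := nat_AGM2 n (4 * a + 2 - n); rewrite subnKC; last lia.
by move: (n * _) lt_a => q; rewrite -mulnn; clear; nia.
Qed.

(** * From outlines to the partition *)

Lemma realization_of_parts (a : nat) (hs : seq nat) :
  0 < a -> (forall p, p \in hs -> 0 < p <= a) -> sorted geq hs ->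
  exists n (L : 'M['I_n]_n), realization [:: a, a, a & hs] L.
Proof.
move=> a0 hsP hs_sorted; pose b := head 0 hs.
have ba : b <= a.
  rewrite /b; case: (hs) hsP => //= p hs' /(_ p); rewrite mem_head.
  by case/(_ isT)/andP.
have size_b x : block_size hs x <= b.
  rewrite /block_size /b; case: hs hs_sorted {hsP b ba} => [|p hs']; first by rewrite nth_nil.
  move=> /= /(order_path_min (rev_trans leq_trans)) /allP min_p; case: (block _ x) => //= i.
  case: (ltnP i (size hs')) => [lt_i|le_i]; last by rewrite nth_default.
  by apply: min_p; apply: mem_nth.
(* A variable n can be destructed, as the cyclic group of the layers lives on ['I_n.+1]. *)
have [n n_sum] : {n | n = sumn hs} by exists (sumn hs).
have [T [T_out T_block]] : exists T : 'I_n -> 'I_n -> 'I_n -> bool,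
    outline_over a (fun u v w => T u v w : nat) /\
    forall u v w : 'I_n, block hs u == block hs v -> T u v w = block_latin hs u v w.
  have [/andP[b0 le_n]|n_small] := boolP ((0 < b) && (a + 2 * b <= n + 1)).
    case: n n_sum le_n => [|n] n_sum le_n; first by lia.
    exact: large_embedding.
  exists (block_latin (n := n) hs); split=> //; apply: (@small_embedding _ _ _ b) => //.
  move: n_small; rewrite negb_and -leqNgt leqn0 -ltnNge => /orP[/eqP b0|]; last by right.
  left; rewrite n_sum; move: b0 hsP; rewrite /b; case: (hs) => //= p hs' -> /(_ 0).
  by rewrite mem_head => /(_ isT).
have [x [x12 x13 x23 xT x_diag]] := T_out.
pose part (i : 'I_n + 'I_3) : 'I_(size [:: a, a, a & hs]) :=
  inord (match i with inl u => (block hs u).+3 | inr i => i end).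
have block_lt (u : 'I_n) : block hs u < size hs.
  by apply: reshape_indexP; rewrite -n_sum.
have partE (i : 'I_n + 'I_3) :
    part i = match i with inl u => (block hs u).+3 | inr i => i end :> nat.
  by case: i => [u|i]; rewrite inordK //= ?ltnS ?block_lt //; have := ltn_ord i; lia.
apply: (realization_of_outline (x := x) (w := glue_weight a) (part := part)) => //.
- by move=> p; rewrite !inE => /or4P[/eqP->|/eqP->|/eqP->|/hsP/andP[]].
- by case.
- move=> g; rewrite big_sumType /=.
  rewrite (eq_bigl (fun u : 'I_n => (block hs u).+3 == g)) => [|u]; last first.
    by rewrite -val_eqE /= partE.
  rewrite (eq_bigl (fun i : 'I_3 => i == g :> nat)) => [|u]; last first.
    by rewrite -val_eqE /= partE.
  rewrite big_mkcond [X in _ + X]big_mkcond sum_ord3 /=.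
  case: g => -[|[|[|g]]] lt_g /=; try by rewrite big1 ?add0n ?addn0.
  rewrite !addn0 -[RHS](card_block n_sum); apply: eq_bigr => u _.
  by rewrite !eqSS; case: eqP.
move=> i j l x_pos e; apply: val_inj; move/(congr1 val): e; rewrite /= !partE.
case: i j x_pos => [u|i] [v|j] x_pos.
(* Inside a block the weight 1 of the cell is used up by T, which leaves nothing for a large
   symbol. *)
- move=> [/eqP e]; have T1 : \sum_w (T u v w : nat) = 1.
    by under eq_bigr do rewrite T_block //; rewrite block_latin12 // e.
  case: l x_pos => [w|k]; rewrite ?xT.
    by rewrite T_block //; case: (boolP (block_latin _ _ _ _)) => // /and3P[/eqP-> /eqP->].
  have := x12 (inl u) (inl v); rewrite big_sumType /=.
  by under eq_bigr do rewrite xT; rewrite T1 (bigD1 k) //=; lia.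
- by have := ltn_ord j; lia.
- by have := ltn_ord i; lia.
by move=> /val_inj e; move: x_pos; rewrite e => /x_diag->.
Qed.

Theorem theorem3p6 (m k : nat) (h : nat -> nat)
  (hm : 3 <= m) (hmk : m <= k)
  (hpos : forall i, m <= i <= k -> 0 < h i)
  (hdec : forall i, m <= i < k -> h i.+1 <= h i) :
  exists (n : nat) (L : 'M['I_n]_n),
    realization (nseq m (h m) ++ [seq h i | i <- index_iota m.+1 k.+1]) L.
Proof.
have h_mono i j : m <= i -> i <= j -> j <= k -> h j <= h i.
  move=> mi; elim: j => [|j IHj] ij jk; first by move: ij; rewrite leqn0 => /eqP->.
  move: ij; rewrite leq_eqVlt => /orP[/eqP->//|]; rewrite ltnS => ij.
  by apply: leq_trans (hdec j _) (IHj ij (ltnW jk)); rewrite (leq_trans mi ij).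
(* Three copies of [h m] become the large parts; the other m - 3 join the small ones, which may thus
   be as large as a. *)
have [m' em] : exists m', m = m'.+3 by exists (m - 3); lia.
have -> : nseq m (h m) ++ [seq h i | i <- index_iota m.+1 k.+1] =
    [:: h m, h m, h m & nseq m' (h m) ++ [seq h i | i <- index_iota m.+1 k.+1]].
  by rewrite {1}em.
have iotaP i : i \in index_iota m.+1 k.+1 -> m < i <= k by rewrite mem_index_iota.
apply: realization_of_parts.
- by apply: hpos; rewrite leqnn.
- move=> p; rewrite mem_cat mem_nseq => /orP[/andP[_ /eqP->]|].
    by rewrite leqnn hpos ?leqnn.
  move=> /mapP[i /iotaP/andP[mi ik] ->].
  by rewrite hpos ?(ltnW mi) //= h_mono // ltnW.
rewrite (sorted_pairwise (rev_trans leq_trans)) pairwise_cat.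
apply/and3P; split.
- apply/allrelP => x y; rewrite mem_nseq => /andP[_ /eqP->] /mapP[i /iotaP/andP[mi ik] ->].
  by rewrite /= h_mono // ltnW.
- by elim: m' {em} => //= j ->; rewrite andbT; apply/allP => x /nseqP[->].
rewrite pairwise_map.
apply: (@sub_in_pairwise _ [pred i | m < i <= k] ltn) => [i j||].
- rewrite !inE => /andP[mi _] /andP[_ jk] lt_ij.
  by rewrite /= h_mono // ltnW.
- by apply/allP => i /iotaP.
by rewrite -(sorted_pairwise ltn_trans) iota_ltn_sorted.
Qed.
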